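(* Let $K$ be a quadratic field with ring of integers $\mathcal{O}$, let $k\geqslant 2$ be a fixed integer, and let $(\mathbb{X}_{\mathcal{B}},\mathbb{Z}^2)$ be the $k$-free shift induced by $K$. Then the centraliser is $\mathcal{S}(\mathbb{X}_{\mathcal{B}})=\mathcal{G}=\mathbb{Z}^2$, and the normaliser is of the form $\mathcal{R}(\mathbb{X}_{\mathcal{B}})=\mathcal{S}(\mathbb{X}_{\mathcal{B}})\rtimes\mathcal{H}$ with $\mathcal{H}\simeq\mathcal{O}^{\times}\rtimes\mathrm{Aut}_{\mathbb{Q}}(K)$, where $\mathrm{Aut}_{\mathbb{Q}}(K)=\mathrm{Gal}(K/\mathbb{Q})$.
   Context: Write $K=\mathbb{Q}(\sqrt{d})$ with $d\in\mathbb{Z}\setminus\{0,1\}$ square-free, and $\mathcal{O}=\mathbb{Z}\oplus\mathbb{Z}\delta$ with $\delta=\sqrt{d}$ if $d\equiv 2,3\bmod 4$ and $\delta=\frac{1+\sqrt{d}}{2}$ if $d\equiv 1\bmod 4$. An element $0\neq x\in\mathcal{O}$ is $k$-free if $v_{\mathfrak{p}}(x)<k$ for all prime ideals $\mathfrak{p}$ of $\mathcal{O}$, where $v_{\mathfrak{p}}(x)$ is the exponent of $\mathfrak{p}$ in the factorisation of $(x)$. Let $V'_k=\{(m_1,m_2)\in\mathbb{Z}^2 : m_1+m_2\delta \text{ is } k\text{-free}\}$. Subsets of $\mathbb{Z}^2$ are identified with their characteristic functions in $\{0,1\}^{\mathbb{Z}^2}$ (product topology), on which $\mathbb{Z}^2$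 acts by translation. The $k$-free shift induced by $K$ is the translation orbit closure $\mathbb{X}_{\mathcal{B}}=\overline{\{t+V'_k : t\in\mathbb{Z}^2\}}$ with the $\mathbb{Z}^2$-translation action; this action is faithful and $\mathcal{G}=\mathbb{Z}^2$ denotes the translation group, viewed as a subgroup of the group $\mathrm{Aut}(\mathbb{X}_{\mathcal{B}})$ of all homeomorphisms of $\mathbb{X}_{\mathcal{B}}$. The (topological) centraliser and normaliser are $$\mathcal{S}(\mathbb{X}_{\mathcal{B}})=\{H\in\mathrm{Aut}(\mathbb{X}_{\mathcal{B}}) : GH=HG\text{ for all }G\in\mathcal{G}\},\qquad \mathcal{R}(\mathbb{X}_{\mathcal{B}})=\{H\in\mathrm{Aut}(\mathbb{X}_{\mathcal{B}}) : H\mathcal{G}H^{-1}=\mathcal{G}\}.$$ In $\mathcal{O}^{\times}\rtimes\mathrm{Aut}_{\mathbb{Q}}(K)$, the Galois group acts on the unit group in the natural way. *)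

(* Defs.v *)
From HB Require Import structures.
From mathcomp Require Import all_boot all_order all_algebra all_field.
From mathcomp Require Import all_classical all_reals all_analysis.

Set Implicit Arguments.
Unset Strict Implicit.
Unset Printing Implicit Defensive.

Import Order.TTheory GRing.Theory Num.Theory.
Local Open Scope classical_set_scope.
Local Open Scope ring_scope.

Section Subgroups.
Local Open Scope group_scope.
Variable G : groupType.

Definition is_subgroup (A : set G) : Prop := group_closed (mem A).

Definition is_normal_in (N R : set G) : Prop :=
  N `<=` R /\ forall r n, R r -> N n -> N (r * n * r^-1).

Definition is_sdprod (N H R : set G) : Prop :=
  [/\ [/\ is_subgroup N, is_subgroup H & is_subgroup R],
      is_normal_in N R, H `<=` R, N `&` H = [set 1] &
      [set n * h | n in N & h in H] = R].

Definition centraliser (T : set G) : set G :=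
  [set h | forall g, T g -> g * h = h * g].

Definition normaliser (T : set G) : set G :=
  [set h | [set h * g * h^-1 | g in T] = T].

Definition is_isomorphic_to (A : set G) (L : groupType) : Prop :=
  exists f : L -> G,
    [/\ {morph f : x y / x * y}, injective f & range f = A].

End Subgroups.

Record aut_action (H N : groupType) := AutAction {
  aact :> H -> N -> N;
  aact1 : forall n, aact 1%g n = n;
  aactM : forall g h n, aact (g * h)%g n = aact g (aact h n);
  aact_morph : forall h, {morph aact h : m n / (m * n)%g} }.

Definition semidirect (H N : groupType) (a : aut_action H N) : Type := (N * H)%type.

Section Semidirect.
Local Open Scope group_scope.
Variables (H N : groupType) (a : aut_action H N).

HB.instance Definition _ := Choice.copy (semidirect a) (N * H)%type.

Let T := semidirect a.

Definition sd_one : T := (1, 1).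
Definition sd_mul (x y : T) : T := (x.1 * a x.2 y.1, x.2 * y.2).
Definition sd_inv (x : T) : T := (a x.2^-1 x.1^-1, x.2^-1).

Lemma aactn1 h : a h 1 = 1.
Proof. by apply: (mulgI (a h 1)); rewrite -aact_morph !mulg1. Qed.

Lemma sd_mulA : associative sd_mul.
Proof. by case=> [m g] [n h] [p l]; rewrite /sd_mul /= aact_morph aactM !mulgA. Qed.

Lemma sd_mul1 : left_id sd_one sd_mul.
Proof. by case=> [n h]; rewrite /sd_mul /= aact1 !mul1g. Qed.

Lemma sd_mulr1 : right_id sd_one sd_mul.
Proof. by case=> [n h]; rewrite /sd_mul /= aactn1 !mulg1. Qed.

Lemma sd_mulV : left_inverse sd_one sd_inv sd_mul.
Proof. by case=> [n h]; rewrite /sd_mul /sd_inv /= -aact_morph !mulVg aactn1. Qed.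

Lemma sd_mulrV : right_inverse sd_one sd_inv sd_mul.
Proof. by case=> [n h]; rewrite /sd_mul /sd_inv /= -aactM !mulgV aact1 mulgV. Qed.

HB.instance Definition _ := isGroup.Build (semidirect a)
  sd_mulA sd_mul1 sd_mulr1 sd_mulV sd_mulrV.
End Semidirect.

Record homeo (X : topologicalType) := Homeo {
  hfun :> X -> X;
  hinv : X -> X;
  hfunK : cancel hfun hinv;
  hinvK : cancel hinv hfun;
  hfun_continuous : continuous hfun;
  hinv_continuous : continuous hinv }.

Section Homeo.
Variable X : topologicalType.
Implicit Types f g h : homeo X.

HB.instance Definition _ := gen_eqMixin (homeo X).
HB.instance Definition _ := gen_choiceMixin (homeo X).

Lemma homeo_ext f g : f =1 g -> f = g.
Proof.
case: f g => [f f' fK f'K cf cf'] [g g' gK g'K cg cg'] /= /funext fg.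
case: _ / fg in gK g'K cg *.
have fg' : f' = g' by apply/funext => x; rewrite -{1}(g'K x) fK.
case: _ / fg' in gK g'K cg' *.
by congr Homeo; exact: Prop_irrelevance.
Qed.

Definition homeo_one : homeo X :=
  @Homeo X idfun idfun (fun=> erefl) (fun=> erefl) (@cts_fun _ _ idfun) (@cts_fun _ _ idfun).

Definition homeo_inv f : homeo X :=
  Homeo (@hinvK _ f) (@hfunK _ f) (@hinv_continuous _ f) (@hfun_continuous _ f).

Lemma continuous_hcomp (u v : X -> X) :
  continuous u -> continuous v -> continuous (u \o v).
Proof. by move=> cu cv x; apply: continuous_comp; [exact: cv|exact: cu]. Qed.

Definition homeo_mul f g : homeo X :=
  Homeo (can_comp (@hfunK _ f) (@hfunK _ g)) (can_comp (@hinvK _ g) (@hinvK _ f))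
    (continuous_hcomp (@hfun_continuous _ f) (@hfun_continuous _ g))
    (continuous_hcomp (@hinv_continuous _ g) (@hinv_continuous _ f)).

Lemma homeo_mulA : associative homeo_mul.
Proof. by move=> f g h; apply: homeo_ext. Qed.

Lemma homeo_mul1 : left_id homeo_one homeo_mul.
Proof. by move=> f; apply: homeo_ext. Qed.

Lemma homeo_mulr1 : right_id homeo_one homeo_mul.
Proof. by move=> f; apply: homeo_ext. Qed.

Lemma homeo_mulV : left_inverse homeo_one homeo_inv homeo_mul.
Proof. by move=> f; apply: homeo_ext => x /=; rewrite hfunK. Qed.

Lemma homeo_mulrV : right_inverse homeo_one homeo_inv homeo_mul.
Proof. by move=> f; apply: homeo_ext => x /=; rewrite hinvK. Qed.

HB.instance Definition _ := isGroup.Build (homeo X)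
  homeo_mulA homeo_mul1 homeo_mulr1 homeo_mulV homeo_mulrV.
End Homeo.

Definition config : topologicalType := prod_topology (fun _ : int * int => bool).

Definition char_fun (A : set (int * int)) : config := fun n => `[< A n >].

(** [tshift t] sends the characteristic function of [A] to that of [t + A]. *)
Definition tshift (t : int * int) (x : config) : config := fun n => x (n - t).

Definition orbit_closure (x : config) : set config :=
  closure [set tshift t x | t in [set: int * int]].

Lemma tshift0 x : tshift 0 x = x.
Proof. by apply/funext => n; rewrite /tshift subr0. Qed.

Lemma tshiftD s t x : tshift (s + t) x = tshift s (tshift t x).
Proof. by apply/funext => n; rewrite /tshift opprD addrA. Qed.

Lemma tshift_continuous t : continuous (tshift t).
Proof.
move=> x; apply/cvg_sup => n.
apply: (@continuous_comp_initial _ _ _ (fun f : config => f n) (tshift t)).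
exact: (@proj_continuous _ (fun _ : int * int => bool) (n - t)).
Qed.

Lemma orbit_closure_tshift v t x :
  x \in orbit_closure v -> tshift t x \in orbit_closure v.
Proof.
move=> /set_mem vx; apply/mem_set => B Bx.
have /vx[_ [[s _ <-] Bs]] := @tshift_continuous t x B Bx.
by exists (tshift t (tshift s v)); split=> //; exists (t + s) => //; rewrite tshiftD.
Qed.

Section Translation.
Variable v : config.

Definition translate (t : int * int) (x : orbit_closure v) : orbit_closure v :=
  exist _ (tshift t (val x)) (orbit_closure_tshift t (valP x)).

Lemma translateK t : cancel (translate t) (translate (- t)).
Proof. by move=> x; apply: val_inj; rewrite /= -tshiftD addNr tshift0. Qed.

Lemma translateNK t : cancel (translate (- t)) (translate t).
Proof. by move=> x; apply: val_inj; rewrite /= -tshiftD addrN tshift0. Qed.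

Lemma translate_continuous t : continuous (translate t).
Proof.
apply: continuous_comp_initial => x.
apply: (@continuous_comp _ _ _ (@set_val _ (orbit_closure v)) (tshift t)).
  exact: initial_continuous.
exact: tshift_continuous.
Qed.

Definition translation (t : int * int) : homeo (orbit_closure v) :=
  Homeo (translateK t) (translateNK t)
    (@translate_continuous t) (@translate_continuous (- t)).

End Translation.

Section Ideals.
Variable R : comNzRingType.
Implicit Types (I J P : set R) (x : R).

(** [idealr_closed] includes that the ideal is proper. *)
Definition prime_ideal P : Prop :=
  idealr_closed (mem P) /\ prime_idealr_closed (mem P).

Definition principal x : set R := [set y * x | y in [set: R]].

Definition ideal_mul I J : set R :=
  [set x | exists2 s : seq (R * R),
     forall p, p \in s -> I p.1 /\ J p.2 & x = \sum_(p <- s) p.1 * p.2].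

Definition prime_factorisation I (s : seq (set R)) : Prop :=
  (forall P, P \in s -> prime_ideal P) /\ \big[ideal_mul/[set: R]]_(P <- s) P = I.

(** [v_P(x)], for [x != 0] in a ring where non-zero ideals factor uniquely;
    [xget] would return [0] if [(x)] had no factorisation. The zero ideal is
    prime here, but does not occur in the factorisation of a non-zero ideal. *)
Definition ideal_valuation P x : nat :=
  xget 0%N [set n | exists2 s, prime_factorisation (principal x) s & count_mem P s = n].

Definition kfree (k : nat) x : Prop :=
  x != 0 /\ forall P, prime_ideal P -> (ideal_valuation P x < k)%N.

End Ideals.

(** A unit is encoded together with its inverse. *)
Record units (R : comNzRingType) := Units {
  upair :> R * R;
  upairP : upair.1 * upair.2 == 1 }.

HB.instance Definition _ R := [isSub for @upair R].
HB.instance Definition _ (R : comNzRingType) := [Choice of units R by <:].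

Section UnitGroup.
Variable R : comNzRingType.
Implicit Types u w : units R.

Definition uval u : R := u.1.

Lemma uval_inj : injective uval.
Proof.
move=> u w uw; apply: val_inj => /=; move: (upairP u) (upairP w) uw; rewrite /uval.
move: (upair u) (upair w) => [a a'] [b b'] /= /eqP aa' /eqP bb' ab.
rewrite -ab in bb' *; congr (_, _).
by rewrite -[LHS]mul1r -bb' mulrAC aa' mul1r.
Qed.

Lemma unit_one_subproof : (1 : R) * 1 == 1. Proof. by rewrite mulr1. Qed.
Lemma unit_inv_subproof u : u.2 * u.1 == 1.
Proof. by rewrite mulrC upairP. Qed.
Lemma unit_mul_subproof u w : (u.1 * w.1) * (u.2 * w.2) == 1.
Proof. by rewrite mulrACA (eqP (upairP u)) (eqP (upairP w)) mulr1. Qed.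

Definition unit_one : units R := @Units R (1, 1) unit_one_subproof.
Definition unit_inv u : units R := @Units R (u.2, u.1) (unit_inv_subproof u).
Definition unit_mul u w : units R :=
  @Units R (u.1 * w.1, u.2 * w.2) (unit_mul_subproof u w).

Lemma unit_mulA : associative unit_mul.
Proof. by move=> u w z; apply: uval_inj; rewrite /uval /= mulrA. Qed.
Lemma unit_mul1 : left_id unit_one unit_mul.
Proof. by move=> u; apply: uval_inj; rewrite /uval /= mul1r. Qed.
Lemma unit_mulr1 : right_id unit_one unit_mul.
Proof. by move=> u; apply: uval_inj; rewrite /uval /= mulr1. Qed.
Lemma unit_mulV : left_inverse unit_one unit_inv unit_mul.
Proof. by move=> u; apply: uval_inj; apply/eqP; rewrite /uval /= mulrC upairP. Qed.
Lemma unit_mulrV : right_inverse unit_one unit_inv unit_mul.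
Proof. by move=> u; apply: uval_inj; apply/eqP; rewrite /uval /= upairP. Qed.

HB.instance Definition _ := isGroup.Build (units R)
  unit_mulA unit_mul1 unit_mulr1 unit_mulV unit_mulrV.

End UnitGroup.

Section NumberField.
Variable K : fieldExtType rat.

Definition algebraic_integers : {pred K} :=
  [pred x | `[< integralOver (intr : int -> K) x >]].

Lemma algebraic_integers_subring : subring_closed algebraic_integers.
Proof.
split=> [|x y /asboolP ix /asboolP iy|x y /asboolP ix /asboolP iy]; apply/asboolP.
- exact: (integral1 (intr : {rmorphism int -> K})).
- exact: (integral_sub (RtoK := intr : {rmorphism int -> K})).
- exact: (integral_mul (RtoK := intr : {rmorphism int -> K})).
Qed.

HB.instance Definition _ :=
  GRing.isSubringClosed.Build K algebraic_integers algebraic_integers_subring.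

Record ring_of_integers := RingOfIntegers {
  oval :> K;
  ovalP : oval \in algebraic_integers }.

HB.instance Definition _ := [isSub for oval].
HB.instance Definition _ := [Choice of ring_of_integers by <:].
HB.instance Definition _ := [SubChoice_isSubComNzRing of ring_of_integers by <:].

(** [Aut_Q(K)]: since [K] is a finite extension of [Q], every [Q]-algebra
    endomorphism of [K] is an automorphism. The product is composition
    [s \o t], the opposite of the law of the library on ['AEnd(K)]. *)
Definition galois_group : Type := 'AEnd(K).

HB.instance Definition _ := Choice.on galois_group.

Definition galois_one : galois_group := \1%AF.
Definition galois_mul (s t : galois_group) : galois_group := (s \o t)%AF.
Definition galois_inv (s : galois_group) : galois_group := inv_ahom s.

Lemma galois_mulA : associative galois_mul.
Proof. by move=> f g h; apply: val_inj; apply: comp_lfunA. Qed.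
Lemma galois_mul1 : left_id galois_one galois_mul.
Proof. by move=> f; apply: val_inj; apply: comp_lfun1l. Qed.
Lemma galois_mulr1 : right_id galois_one galois_mul.
Proof. by move=> f; apply: val_inj; apply: comp_lfun1r. Qed.
Lemma galois_mulV : left_inverse galois_one galois_inv galois_mul.
Proof. by move=> f; apply: val_inj; rewrite /= lker0_compVf ?AEnd_lker0. Qed.
Lemma galois_mulrV : right_inverse galois_one galois_inv galois_mul.
Proof. by move=> f; apply: val_inj; rewrite /= lker0_compfV ?AEnd_lker0. Qed.

HB.instance Definition _ := isGroup.Build galois_group
  galois_mulA galois_mul1 galois_mulr1 galois_mulV galois_mulrV.

Lemma gal_integral (s : galois_group) (x : ring_of_integers) :
  (s : 'AEnd(K)) (oval x) \in algebraic_integers.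
Proof.
have /asboolP[p pm px] := ovalP x; apply/asboolP; exists p => //.
have -> : map_poly (intr : int -> K) p = map_poly (s : 'AEnd(K)) (map_poly intr p).
  by rewrite -map_poly_comp; apply: eq_map_poly => i /=; rewrite rmorph_int.
by rewrite fmorph_root.
Qed.

Definition gal_int (s : galois_group) (x : ring_of_integers) : ring_of_integers :=
  RingOfIntegers (gal_integral s x).

Lemma gal_unit_subproof (s : galois_group) (u : units ring_of_integers) :
  gal_int s u.1 * gal_int s u.2 == 1.
Proof.
apply/eqP/val_inj; rewrite /= -rmorphM /=.
by have /eqP/(congr1 val)/= -> := upairP u; rewrite rmorph1.
Qed.

Definition gal_unit (s : galois_group) (u : units ring_of_integers) :
  units ring_of_integers := @Units _ (gal_int s u.1, gal_int s u.2) (gal_unit_subproof s u).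

Lemma gal_unit1 u : gal_unit 1%g u = u.
Proof. by apply/uval_inj/val_inj; rewrite /= id_lfunE. Qed.

Lemma gal_unitM s t u : gal_unit (s * t)%g u = gal_unit s (gal_unit t u).
Proof. by apply/uval_inj/val_inj; rewrite /= comp_lfunE. Qed.

Lemma gal_unit_morph s : {morph gal_unit s : u w / (u * w)%g}.
Proof. by move=> u w; apply/uval_inj/val_inj; rewrite /= rmorphM. Qed.

Definition gal_action : aut_action galois_group (units ring_of_integers) :=
  AutAction gal_unit1 gal_unitM gal_unit_morph.

End NumberField.

Definition square_free (d : int) : Prop :=
  forall m : int, (m ^+ 2 %| d)%Z -> m \is a GRing.unit.

Section QuadraticField.
(** [K = Q(r)] with [r] playing the role of [sqrt d]. *)
Variables (K : fieldExtType rat) (d : int) (r : K).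

Definition delta : K := if (d == 1 %[mod 4])%Z then (1 + r) / 2%:R else r.

Definition kfree_points (k : nat) : set (int * int) :=
  [set m | exists2 x : ring_of_integers K,
     oval x = m.1%:~R + m.2%:~R * delta & kfree k x].

End QuadraticField.

(* Main.v *)
(** The prime ideals of [O] are controlled by the norm form: for a non-zero ideal
    [I], the product [I * conj I] is generated by the least positive integer it
    contains, because [a * conj b / g] has integral trace and norm.  Hence
    containing is dividing, ideals factor uniquely, and [x] is [k]-free iff it
    lies in no [P ^ k].

    Sieving over a two-dimensional box (a non-zero element of [P ^ 2] has norm
    divisible by [l ^ 2], so its lattice points are spread out) shows that a
    finite set avoiding a class modulo the small primes is, up to translation,
    exactly the [k]-free pattern in any given window.

    Let a homeomorphism [h] satisfy [h T_t = T_(M t) h] with [M] in GL(2, Z), and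
    normalise it by a translation so that [0] belongs to [h {0}].  By continuity,
    [h A] contains [M A] for finite sets [A] that are spread out enough.  Choose
    [A] to avoid [0] modulo the two prime powers above a large split prime [l]:
    if [M] were neither [x |-> u x] nor [x |-> u * conj x], then [M A] could be
    made to meet every class modulo one of them, which no element of the shift
    does.  After dividing by this symmetry [h] commutes with translations, and
    the same covering trick shows that [h P] is contained in [P] for finite [P];
    applied also to the inverse of [h] this gives [h P = P], hence [h = id] by density. *)

From HB Require Import structures.
Require Import Defs.
From mathcomp Require Import all_boot all_order all_algebra all_field.
From mathcomp Require Import all_classical all_reals all_analysis.
From mathcomp Require Import ring lra zify.

Set Implicit Arguments.
Unset Strict Implicit.
Unset Printing Implicit Defensive.

Import Order.TTheory GRing.Theory Num.Theory.
Local Open Scope classical_set_scope.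
Local Open Scope ring_scope.

(** Continuity makes [h] local near each single configuration, but nothing forces [h] to respect
    inclusion of sets. The only non-empty configuration controlled from the start is {0}, so a point
    can be traced through [h] only where it is isolated; hence the spread-out test sets, whose
    points may be moved freely inside their residue classes. All contradictions come from one
    obstruction: on a finite window an element of the shift is the k-free set moved by some -u, so
    its points there miss the class of -u modulo every P^k. The prime is taken split so that the
    quotient by P^k is Z/l^k, and so that the conditions on the test set, at P and at its conjugate,
    become two independent coordinates. If al * x + be * conj x has both coefficients non-zero, it
    mixes these coordinates and takes every value while neither of them vanishes. When M is the
    identity, the test set meets every class but one, and a point of h P outside P supplies the
    missing class. *)

(** * Maximal quadratic orders *)

(** [R] is free over Z on [1] and [dl], an element of trace [tau] and norm [nu];
    [saturated] expresses that the order is maximal. *)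
Record quad_ring (R : comNzRingType) := QuadRing {
  cj : {rmorphism R -> R};
  dl : R;
  tau : int;
  nu : int;
  co : R -> int * int;
  coK : forall x, (co x).1%:~R + (co x).2%:~R * dl = x;
  co_pt : forall a b, co (a%:~R + b%:~R * dl) = (a, b);
  cj_dl : cj dl = tau%:~R - dl;
  dl_cj : dl * cj dl = nu%:~R;
  form_aniso : forall a b, a * a + tau * a * b + nu * b * b = 0 -> a = 0 /\ b = 0;
  saturated : forall (g : int) x, g != 0 ->
    (g %| (co x).1 * 2 + tau * (co x).2)%Z ->
    (g * g %| (co x).1 * (co x).1 + tau * (co x).1 * (co x).2 + nu * (co x).2 * (co x).2)%Z ->
    exists y, x = g%:~R * y }.

Section QuadRing.
Variables (R : comNzRingType) (Q : quad_ring R).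
Local Notation cj := (cj Q).
Local Notation dl := (dl Q).
Local Notation tau := (tau Q).
Local Notation nu := (nu Q).
Local Notation co := (co Q).
Implicit Types (x y z a b : R) (I J P : set R).

Definition pt (m : int * int) : R := m.1%:~R + m.2%:~R * dl.
Definition tr x : int := (co x).1 * 2 + tau * (co x).2.
Definition nm x : int :=
  (co x).1 * (co x).1 + tau * (co x).1 * (co x).2 + nu * (co x).2 * (co x).2.

Lemma ptK : cancel pt co.
Proof. by case=> a b; rewrite /pt co_pt. Qed.

Lemma coKpt : cancel co pt.
Proof. exact: coK. Qed.

Lemma ptD m n : pt (m + n) = pt m + pt n.
Proof. by rewrite /pt /= !intrD; ring. Qed.

Lemma ptN m : pt (- m) = - pt m.
Proof. by rewrite /pt /= !intrN; ring. Qed.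

Lemma pt0 : pt 0 = 0.
Proof. by rewrite /pt /=; ring. Qed.

Lemma coD x y : co (x + y) = co x + co y.
Proof. by apply: (can_inj ptK); rewrite ptD !coKpt. Qed.

Lemma coN x : co (- x) = - co x.
Proof. by apply: (can_inj ptK); rewrite ptN !coKpt. Qed.

Lemma coB x y : co (x - y) = co x - co y.
Proof. by rewrite coD coN. Qed.

Lemma co_int n : co n%:~R = (n, 0).
Proof. by rewrite -[n%:~R]addr0 -(mul0r dl) -[0]/(0%:~R) co_pt. Qed.

Lemma coZ n x : co (n%:~R * x) = (n * (co x).1, n * (co x).2).
Proof. by rewrite -{1}(coK Q x) mulrDr mulrA -!intrM co_pt. Qed.

Lemma intr_injR : injective (intr : int -> R).
Proof. by move=> m n /(congr1 co); rewrite !co_int => -[]. Qed.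

Lemma intr_dvd (g n : int) x : n%:~R = g%:~R * x -> (g %| n)%Z.
Proof. by move=> /(congr1 co); rewrite co_int coZ => -[-> _]; exact: dvdz_mulr. Qed.

Lemma intr_mulI (g : int) x y : g != 0 -> g%:~R * x = g%:~R * y -> x = y.
Proof.
move=> g0 /(congr1 co); rewrite !coZ => -[/(mulfI g0) e1 /(mulfI g0) e2].
by rewrite -(coK Q x) -(coK Q y) e1 e2.
Qed.

Lemma cjE x : cj x = (co x).1%:~R + (co x).2%:~R * (tau%:~R - dl).
Proof. by rewrite -{1}(coK Q x) rmorphD rmorphM !rmorph_int cj_dl. Qed.

Lemma cjK : involutive cj.
Proof.
by move=> x; rewrite -{2}(coK Q x) (cjE x) rmorphD rmorphM rmorphB !rmorph_int /= cj_dl; ring.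
Qed.

Lemma trE x : (tr x)%:~R = x + cj x.
Proof. by rewrite cjE -[X in X + _](coK Q x) /tr; ring. Qed.

Lemma nmE x : (nm x)%:~R = x * cj x.
Proof.
have dd : dl * (tau%:~R - dl) = nu%:~R by rewrite -(dl_cj Q) cj_dl.
rewrite cjE -[X in X * _](coK Q x) /nm !intrD !intrM -dd; ring.
Qed.

Lemma nmM x y : nm (x * y) = nm x * nm y.
Proof. by apply: intr_injR; rewrite intrM !nmE rmorphM; ring. Qed.

Lemma nm_cj x : nm (cj x) = nm x.
Proof. by apply: intr_injR; rewrite !nmE cjK mulrC. Qed.

Lemma nm_int n : nm n%:~R = n * n.
Proof. by apply: intr_injR; rewrite nmE rmorph_int intrM. Qed.

Lemma nm_eq0 x : (nm x == 0) = (x == 0).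
Proof.
apply/eqP/eqP => [/(@form_aniso _ Q)[e1 e2]|->]; last by rewrite -[0]/(0%:~R) nm_int.
by rewrite -(coK Q x) e1 e2; ring.
Qed.

Lemma tr_cjM x y : tr (x * cj y) = nm (x + y) - nm x - nm y.
Proof. by apply: intr_injR; rewrite !intrB !nmE trE rmorphM !rmorphD cjK; ring. Qed.

Lemma saturate (g : int) x : g != 0 -> (g %| tr x)%Z -> (g * g %| nm x)%Z ->
  exists y, x = g%:~R * y.
Proof. exact: saturated. Qed.

Record ideal I : Prop := Ideal {
  ideal0 : I 0;
  idealD : forall x y, I x -> I y -> I (x + y);
  idealM : forall x y, I y -> I (x * y) }.

Lemma idealN I x : ideal I -> I x -> I (- x).
Proof. by move=> iI Ix; rewrite -mulN1r; exact: idealM. Qed.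

Lemma idealB I x y : ideal I -> I x -> I y -> I (x - y).
Proof. by move=> iI Ix Iy; apply: idealD => //; exact: idealN. Qed.

Lemma idealMright I x y : ideal I -> I x -> I (x * y).
Proof. by move=> iI Ix; rewrite mulrC; exact: idealM. Qed.

Lemma prime_idealP P :
  prime_ideal P <-> [/\ ideal P, ~ P 1 & forall u v, P (u * v) -> P u \/ P v].
Proof.
split=> [[[P0 P1 PD] Pp]|[[P0 PD PM] P1 Pp]].
  have P0' : P 0 by exact: set_mem.
  have PD' a u v : P u -> P v -> P (a * u + v).
    by move=> Pu Pv; apply/set_mem/PD; exact/mem_set.
  split; last 2 first.
  - by move=> P1'; move/negP: P1; apply; exact/mem_set.
  - move=> u v uv; have := Pp u v; rewrite (mem_set uv).
    by move=> /(_ isT)/orP[]/set_mem; [left|right].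
  - split=> // x y.
      by move=> Px Py; rewrite -(mul1r x); exact: PD'.
    by move=> Py; rewrite -[_ * _]addr0; exact: PD'.
split; first split.
- exact/mem_set.
- by apply/negP => /set_mem.
- by move=> a u v /set_mem Pu /set_mem Pv; apply/mem_set/PD => //; exact: PM.
- by move=> u v /set_mem/Pp[] h; apply/orP; [left|right]; exact/mem_set.
Qed.

Lemma ideal_mul_in I J a b : I a -> J b -> ideal_mul I J (a * b).
Proof.
move=> Ia Jb; exists [:: (a, b)]; last by rewrite big_seq1.
by move=> p; rewrite inE => /eqP ->.
Qed.

Lemma ideal_mul_min I J (T : set R) : T 0 -> (forall x y, T x -> T y -> T (x + y)) ->
  (forall a b, I a -> J b -> T (a * b)) -> ideal_mul I J `<=` T.
Proof.
move=> T0 TD TM x [s sIJ ->]; elim: s sIJ => [|p s IHs] sIJ; first by rewrite big_nil.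
rewrite big_cons; apply: TD; last by apply: IHs => q qs; apply: sIJ; rewrite inE qs orbT.
by have [] := sIJ p (mem_head _ _) => *; exact: TM.
Qed.

Lemma ideal_mulD I J x y : ideal_mul I J x -> ideal_mul I J y -> ideal_mul I J (x + y).
Proof.
move=> [s hs ->] [t ht ->]; exists (s ++ t); last by rewrite big_cat.
by move=> p; rewrite mem_cat => /orP[/hs|/ht].
Qed.

Lemma ideal_mul0 I J : ideal_mul I J 0.
Proof. by exists [::]; rewrite ?big_nil. Qed.

Lemma ideal_mul_ideal I J : ideal I -> ideal (ideal_mul I J).
Proof.
move=> iI; split; [exact: ideal_mul0|exact: ideal_mulD|move=> x y].
apply: (@ideal_mul_min I J [set y | ideal_mul I J (x * y)]) => /=.
- by rewrite mulr0; exact: ideal_mul0.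
- by move=> u v; rewrite mulrDr; exact: ideal_mulD.
- by move=> a b Ia Jb; rewrite mulrA; apply: ideal_mul_in => //; exact: idealM.
Qed.

Lemma ideal_mul_subP I J K : ideal K ->
  (forall a b, I a -> J b -> K (a * b)) -> ideal_mul I J `<=` K.
Proof. by move=> iK h; apply: ideal_mul_min => //; [exact: ideal0|exact: idealD]. Qed.

Lemma ideal_mulS I I' J J' : I `<=` I' -> J `<=` J' -> ideal_mul I J `<=` ideal_mul I' J'.
Proof.
move=> sI sJ; apply: ideal_mul_min; [exact: ideal_mul0|exact: ideal_mulD|].
by move=> a b /sI Ia /sJ Jb; exact: ideal_mul_in.
Qed.

Lemma ideal_mul_subl I J : ideal I -> ideal_mul I J `<=` I.
Proof. by move=> iI; apply: ideal_mul_subP => // a b Ia _; exact: idealMright. Qed.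

Lemma ideal_mul_subr I J : ideal J -> ideal_mul I J `<=` J.
Proof. by move=> iJ; apply: ideal_mul_subP => // a b _; exact: idealM. Qed.

Lemma ideal_mulT I : ideal I -> ideal_mul I setT = I.
Proof.
move=> iI; apply/seteqP; split; first exact: ideal_mul_subl.
by move=> x Ix; rewrite -[x]mulr1; exact: ideal_mul_in.
Qed.

Lemma principal_ideal x : ideal (principal x).
Proof.
split; first by exists 0; rewrite ?mul0r.
- by move=> _ _ [u _ <-] [v _ <-]; exists (u + v); rewrite ?mulrDl.
- by move=> u _ [v _ <-]; exists (u * v); rewrite ?mulrA.
Qed.

Definition conjI I : set R := [set x | I (cj x)].

Lemma conjI_ideal I : ideal I -> ideal (conjI I).
Proof.
move=> iI; split; rewrite /conjI /=.
- by rewrite rmorph0; exact: ideal0.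
- by move=> x y; rewrite rmorphD; exact: idealD.
- by move=> x y; rewrite rmorphM; exact: idealM.
Qed.

(** In other words [I * conjI I = (g)], so that [g] is the absolute norm of [I]. *)
Definition normgen I (g : nat) : Prop :=
  [/\ (0 < g)%N, forall a b, I a -> I b -> exists y, a * cj b = g%:~R * y &
    ideal_mul I (conjI I) g%:~R].

Lemma ideal_int_gen (T : set R) (m : int) : ideal T -> T m%:~R -> m != 0 ->
  exists g : nat, [/\ (0 < g)%N, T g%:~R & forall n : int, T n%:~R -> (g %| n)%Z].
Proof.
move=> iT Tm m0; pose S (n : nat) := (0 < n)%N && `[< T n%:~R >].
have exS : exists n, S n.
  exists `|m|%N; rewrite /S absz_gt0 m0 /=; apply/asboolP.
  have [->//|->] : Posz `|m|%N = m \/ Posz `|m|%N = - m by lia.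
  by rewrite intrN; exact: idealN.
case: (ex_minnP exS) => g /andP[g0 /asboolP Tg] gmin; exists g; split=> // n Tn.
apply/dvdz_mod0P; apply/eqP; apply: contraT => r0.
have g0' : g%:Z != 0 by rewrite -lt0n in g0 *; lia.
have rge := modz_ge0 n g0'.
have rlt : (n %% g)%Z < g by apply: ltz_pmod.
have : S `|(n %% g)%Z|%N.
  rewrite /S absz_gt0 r0 /=; apply/asboolP; rewrite gez0_abs //.
  have -> : (n %% g)%Z = n - (n %/ g)%Z * g by rewrite {2}(divz_eq n g); ring.
  by rewrite intrB intrM; apply: idealB => //; exact: idealM.
by move=> /gmin; lia.
Qed.

Lemma normgen_exists I x : ideal I -> I x -> x != 0 -> exists g, normgen I g.
Proof.
move=> iI Ix x0.
have iII : ideal (ideal_mul I (conjI I)) by exact: ideal_mul_ideal.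
have Inm a : I a -> ideal_mul I (conjI I) (nm a)%:~R.
  by move=> Ia; rewrite nmE; apply: ideal_mul_in => //; rewrite /conjI /= cjK.
have [g [g0 Tg gdvd]] := ideal_int_gen iII (Inm _ Ix) (etrans (congr1 negb (nm_eq0 x)) x0).
exists g; split=> // a b Ia Ib.
have dnm c : I c -> (g %| nm c)%Z by move=> /Inm/gdvd.
(* The trace of [a * cj b] is the polarisation of the norm form: [g] divides it because [a], [b] and
   [a + b] all lie in [I]. *)
apply: saturate; first by lia.
  by rewrite tr_cjM !rpredB //; apply: dnm => //; exact: idealD.
by rewrite nmM nm_cj dvdz_mul ?dnm.
Qed.

(** A strict inclusion strictly lowers the generator. For equal generators write [g] as a sum of
    products [a * b] with [a] in [I] and [b] in [conjI I]; for [x] in [J] each [x * b] is a multiple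
    of [g], so [g * x] lies in [g * I]. *)
Lemma normgen_sub I J g h : ideal I -> ideal J -> normgen I g -> normgen J h ->
  I `<=` J -> (h <= g)%N /\ (h = g -> J `<=` I).
Proof.
move=> iI iJ [g0 gd gin] [h0 hd hin] IJ; split.
  apply: dvdn_leq => //; rewrite -[(h %| g)%N]/(h%:Z %| g%:Z)%Z.
  have /ideal_mul_subP H : forall a b, I a -> conjI I b -> principal h%:~R (a * b).
    move=> a b /IJ Ja /IJ Jb; have [y] := hd _ _ Ja Jb.
    by rewrite cjK => ->; exists y => //; rewrite mulrC.
  have [y _ hy] := H (principal_ideal _) _ gin.
  by apply: (@intr_dvd _ _ y); rewrite mulrC.
move=> hg x Jx; rewrite -{}hg in gd gin.
suff [y Iy e] : exists2 y, I y & x * h%:~R = h%:~R * y.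
  by rewrite (@intr_mulI h x y) // -?e ?(mulrC x) //; lia.
(* The generator occurs both as divisor and as element of the product ideal; only the second
   occurrence, [G'], is decomposed into a sum. *)
move: (h%:~R) gin hd => G; apply: (@ideal_mul_min _ _ [set G' | (forall a b, J a -> J b ->
  exists y, a * cj b = G * y) -> exists2 y, I y & x * G' = G * y]) => /=.
- by exists 0; [exact: ideal0|rewrite !mulr0].
- move=> u v hu hv hd; have [y Iy ey] := hu hd; have [z Iz ez] := hv hd.
  by exists (y + z); [exact: idealD|rewrite !mulrDr ey ez].
- move=> a b Ia Ib hd; have [y] := hd x (cj b) Jx (IJ _ Ib).
  rewrite cjK => e; exists (a * y); first exact: idealMright.
  by rewrite mulrCA e; ring.
Qed.

End QuadRing.

(** * Unique factorisation of ideals *)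

Section Dedekind.
Variables (R : comNzRingType) (Q : quad_ring R).
Local Notation cj := (cj Q).
Implicit Types (x y z a b : R) (I J P : set R).

Definition nonzero I := exists2 x, I x & x != 0.

Lemma nonzeroS I J : I `<=` J -> nonzero I -> nonzero J.
Proof. by move=> IJ [x /IJ Jx x0]; exists x. Qed.

(** Noetherian induction, measured by the generator of [I * conjI I], which drops under strict
    enlargement by [normgen_sub]. *)
Lemma ideal_wf_ind (S : set R -> Prop) :
  (forall I, ideal I -> nonzero I ->
    (forall J, ideal J -> I `<=` J -> ~ (J `<=` I) -> S J) -> S I) ->
  forall I, ideal I -> nonzero I -> S I.
Proof.
move=> IH I iI nI; have [x Ix x0] := nI; have [g gI] := normgen_exists Q iI Ix x0.
have [n le_gn] : exists n, (g <= n)%N by exists g.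
elim: n => [|n IHn] in I iI nI x Ix x0 g gI le_gn *.
  by case: gI; rewrite (leqn0 g) in le_gn; rewrite (eqP le_gn).
apply: IH => // J iJ IJ nJI; have [h hJ] := normgen_exists Q iJ (IJ _ Ix) x0.
have [le_hg ne_hg] := normgen_sub iI iJ gI hJ IJ.
apply: (IHn J iJ (nonzeroS IJ nI) x (IJ _ Ix) x0 h hJ).
rewrite -ltnS (leq_trans _ le_gn) // ltn_neqAle le_hg andbT.
by apply: contra_notN nJI => /eqP.
Qed.

Definition maximal P := [/\ ideal P, ~ P 1 &
  forall J, ideal J -> P `<=` J -> J `<=` P \/ J 1].

Lemma maximal_above I : ideal I -> nonzero I -> ~ I 1 ->
  exists2 P, maximal P & I `<=` P.
Proof.
move=> iI nI; move: I iI nI; apply: ideal_wf_ind => I iI nI IH I1.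
have [[J [iJ IJ nJI nJ1]]|noJ] := pselect (exists J, [/\ ideal J, I `<=` J, ~ (J `<=` I) & ~ J 1]).
  by have [P mP JP] := IH J iJ IJ nJI nJ1; exists P => //; exact: subset_trans JP.
exists I => //; split=> // J iJ IJ; apply: contrapT => /not_orP[nJI nJ1].
by apply: noJ; exists J.
Qed.

Lemma maximal_comax P x : maximal P -> ~ P x -> exists p y, P p /\ 1 = p + y * x.
Proof.
move=> [iP P1 mP] nPx.
pose J := [set z | exists p y, P p /\ z = p + y * x].
have iJ : ideal J.
  split.
  - by exists 0, 0; rewrite mul0r addr0; split=> //; exact: ideal0.
  - move=> _ _ [p [y [Pp ->]]] [q [z [Pq ->]]]; exists (p + q), (y + z).
    by split; [exact: idealD|ring].
  - move=> u _ [p [y [Pp ->]]]; exists (u * p), (u * y).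
    by split; [exact: idealM|ring].
have PJ : P `<=` J by move=> p Pp; exists p, 0; rewrite mul0r addr0.
have [JP|//] := mP J iJ PJ; case: nPx; apply: JP.
by exists 0, 1; rewrite mul1r add0r; split=> //; exact: ideal0.
Qed.

Lemma maximal_prime P : maximal P -> prime_ideal P.
Proof.
move=> mP; have [iP P1 _] := mP; apply/prime_idealP; split=> // u v Puv.
have [|nPu] := pselect (P u); first by left.
have [p [y [Pp e]]] := maximal_comax mP nPu; right.
rewrite -[v]mul1r e mulrDl -mulrA; apply: idealD => //; last exact: idealM.
exact: idealMright.
Qed.

Lemma ideal_mul_mem (P I : set R) (g : nat) p z : normgen Q P g -> ideal I -> P p ->
  ideal_mul (conjI Q P) I z -> exists2 y, I y & p * z = g%:~R * y.
Proof.
move=> [_ gd _] iI Pp.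
apply: (@ideal_mul_min _ _ _ [set z | exists2 y, I y & p * z = g%:~R * y]) => /=.
- by exists 0; [exact: ideal0|rewrite !mulr0].
- move=> u v [y Iy ey] [w Iw ew]; exists (y + w); first exact: idealD.
  by rewrite !mulrDr ey ew.
- move=> a b Pa Ib; have [y] := gd _ _ Pp Pa; rewrite cjK => e.
  by exists (y * b); [exact: idealM|rewrite !mulrA e].
Qed.

(** Since [g] is a sum of products [a * cj b], membership of [g * x] can be tested on each of them.
    This is how an inclusion is multiplied by [P * conjI P]. *)
Lemma normgen_mul (P T : set R) (g : nat) x : normgen Q P g -> ideal T ->
  (forall a b, P a -> P b -> T (a * (cj b * x))) -> T (g%:~R * x).
Proof.
move=> [_ _ gin] iT h.
apply: (@ideal_mul_min _ _ _ [set z | T (z * x)] _ _ _ _ gin) => /=.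
- by rewrite mul0r; exact: ideal0.
- by move=> u v; rewrite mulrDl; exact: idealD.
- by move=> a b Pa Pb; rewrite -(cjK Q b) -mulrA; exact: h.
Qed.

Definition scaleI (g : int) I : set R := [set g%:~R * x | x in I].

Lemma scaleI_ideal g I : ideal I -> ideal (scaleI g I).
Proof.
move=> iI; split; first by exists 0; rewrite ?mulr0 //; exact: ideal0.
- by move=> _ _ [x Ix <-] [y Iy <-]; exists (x + y); rewrite ?mulrDr //; exact: idealD.
- by move=> u _ [x Ix <-]; exists (u * x); [exact: idealM|ring].
Qed.

Lemma contain_divide P I : ideal P -> nonzero P -> ideal I -> I `<=` P ->
  exists2 J, ideal J & ideal_mul P J = I.
Proof.
move=> iP [p Pp p0] iI IP; have [g gP] := normgen_exists Q iP Pp p0.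
have g0 : g%:Z != 0 by case: gP; lia.
(* The cofactor is [conjI P * I] divided by [g]; the division is possible inside the ring because
   [I] is contained in [P]. *)
exists [set y | ideal_mul (conjI Q P) I (g%:~R * y)].
  have iPI : ideal (ideal_mul (conjI Q P) I) by apply: ideal_mul_ideal; exact: conjI_ideal.
  split=> /=.
  - by rewrite mulr0; exact: ideal0.
  - by move=> x y; rewrite mulrDr; exact: idealD.
  - by move=> x y hy; rewrite mulrCA; exact: idealM.
apply/seteqP; split.
  apply: ideal_mul_subP => // a b Pa /(ideal_mul_mem gP iI Pa)[y Iy].
  by rewrite mulrCA => /(intr_mulI Q g0) ->.
move=> x Ix; set J := [set y | _].
suff [y Iy /(intr_mulI Q g0) <-] : scaleI g (ideal_mul P J) (g%:~R * x) by [].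
apply: (normgen_mul (T := scaleI g _) gP); first by apply: scaleI_ideal; exact: ideal_mul_ideal.
move=> a b Pa Pb; have [y ey] := (let: And3 _ gd _ := gP in gd) _ _ (IP _ Ix) Pb.
exists (a * y); last by rewrite (mulrC (cj b)) ey; ring.
apply: ideal_mul_in => //; rewrite /J /= -ey mulrC; apply: ideal_mul_in => //.
by rewrite /conjI /= cjK.
Qed.

Lemma ideal_mulC I J : ideal_mul I J = ideal_mul J I.
Proof.
apply/seteqP; split; apply: ideal_mul_min; 
  by [exact: ideal_mul0|exact: ideal_mulD|move=> a b *; rewrite mulrC; exact: ideal_mul_in].
Qed.

(** Multiplication by [conjI P] replaces [P] by the integer [g], which cancels. *)
Lemma ideal_cancel P I J : ideal P -> nonzero P -> ideal J ->
  ideal_mul P I `<=` ideal_mul P J -> I `<=` J.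
Proof.
move=> iP [p Pp p0] iJ PIJ x Ix; have [g gP] := normgen_exists Q iP Pp p0.
have g0 : g%:Z != 0 by case: gP; lia.
suff [y Jy /(intr_mulI Q g0) <-] : scaleI g J (g%:~R * x) by [].
apply: (normgen_mul (T := scaleI g _) gP); first exact: scaleI_ideal.
move=> a b Pa Pb; rewrite mulrCA.
have : ideal_mul P J (a * x) by apply: PIJ; exact: ideal_mul_in.
apply: (@ideal_mul_min _ _ _ [set z | scaleI g J (cj b * z)]) => /=.
- by rewrite mulr0; apply: ideal0; exact: scaleI_ideal.
- by move=> u v; rewrite mulrDr; apply: idealD; exact: scaleI_ideal.
- move=> u v Pu Jv; have [y ey] := (let: And3 _ gd _ := gP in gd) _ _ Pu Pb.
  by exists (y * v); [exact: idealM|rewrite !mulrA -ey; ring].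
Qed.

Lemma factorisation_exists I : ideal I -> nonzero I -> exists s, prime_factorisation I s.
Proof.
move=> iI nI; move: I iI nI; apply: ideal_wf_ind => I iI nI IH.
have [I1|nI1] := pselect (I 1).
  exists [::]; split=> //; rewrite big_nil; apply/seteqP; split=> // x _.
  by rewrite -[x]mulr1; exact: idealM.
have [P mP IP] := maximal_above iI nI nI1; have [iP P1 _] := mP.
have nP : nonzero P := nonzeroS IP nI.
have [J iJ PJ] := contain_divide iP nP iI IP.
have IJ : I `<=` J by rewrite -PJ; exact: ideal_mul_subr.
(* If [J] were contained in [I = J * P], cancelling [J] would put 1 in [P]. *)
have [JI|s [sP sJ]] := IH J iJ IJ.
  have /ideal_cancel H : ideal_mul J setT `<=` ideal_mul J P.
    by rewrite ideal_mulT // ideal_mulC PJ.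
  by apply: P1; exact: (H iJ (nonzeroS IJ nI) iP).
exists (P :: s); split; last by rewrite big_cons sJ.
by move=> K; rewrite inE => /orP[/eqP ->|/sP //]; exact: maximal_prime.
Qed.

(** Write [P = P' * J]. An element of [P'] outside [P] forces [J] into [P = P' * J], and cancelling
    [J] gives 1 in [P']. *)
Lemma prime_sub_eq P P' : prime_ideal P -> prime_ideal P' -> nonzero P -> P `<=` P' -> P = P'.
Proof.
move=> /prime_idealP[iP P1 pP] /prime_idealP[iP' P1' _] nP PP'.
have nP' := nonzeroS PP' nP.
have [J iJ e] := contain_divide iP' nP' iP PP'.
apply/seteqP; split=> // p P'p; apply: contrapT => nPp.
have JP : J `<=` P.
  move=> q Jq; have /pP[] // : P (p * q) by rewrite -e; exact: ideal_mul_in.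
apply: P1'; have /ideal_cancel : ideal_mul J setT `<=` ideal_mul J P'.
  by rewrite ideal_mulT // ideal_mulC e.
apply=> //; apply: (nonzeroS _ nP); rewrite -e; exact: ideal_mul_subr.
Qed.

Lemma prime_maximal P : prime_ideal P -> nonzero P -> maximal P.
Proof.
move=> pP nP; have /prime_idealP[iP P1 _] := pP; split=> // J iJ PJ.
have [|nJ1] := pselect (J 1); [by right|left].
have [M mM JM] := maximal_above iJ (nonzeroS PJ nP) nJ1.
by rewrite (prime_sub_eq pP (maximal_prime mM) nP) //; exact: subset_trans JM.
Qed.

Definition ipow P n : set R := iter n (ideal_mul P) setT.

Lemma ipow_ideal P n : ideal P -> ideal (ipow P n).
Proof. by case: n => [|n] // iP; apply: ideal_mul_ideal. Qed.

Lemma ipowX P n x : P x -> ipow P n (x ^+ n).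
Proof. by move=> Px; elim: n => [|n IHn] //; rewrite exprS; exact: ideal_mul_in. Qed.

Lemma ipowS P n : ideal P -> ipow P n.+1 `<=` ipow P n.
Proof. by move=> iP; apply: ideal_mul_subr; exact: ipow_ideal. Qed.

Lemma ipow_le P m n : ideal P -> (m <= n)%N -> ipow P n `<=` ipow P m.
Proof.
move=> iP /subnK <-; elim: (n - m)%N => [|i IHi] //.
by apply: subset_trans IHi; rewrite addSn; exact: ipowS.
Qed.

(** Outside the maximal ideal [P], [x] is invertible modulo [P ^ n]: the relation [1 = p + u * x] is
    raised to a power. *)
Lemma ipow_prime P n x y : prime_ideal P -> nonzero P -> ~ P x ->
  ipow P n (x * y) -> ipow P n y.
Proof.
move=> pP nP nPx h; have mP := prime_maximal pP nP; have [iP _ _] := mP.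
have iPn := ipow_ideal n iP.
have [p [u [Pp e]]] := maximal_comax mP nPx.
have [q eq] : exists q, 1 = p ^+ n + q * x.
  elim: (n) => [|m [q eq]]; first by exists 0; rewrite expr0 mul0r addr0.
  exists (q * (p + u * x) + p ^+ m * u).
  by rewrite -[1]mulr1 {1}eq {1}e exprSr; ring.
rewrite -[y]mul1r eq mulrDl -mulrA; apply: idealD => //; last exact: idealM.
by apply: idealMright => //; exact: ipowX.
Qed.

(** A factor different from [P] contains an element outside [P], which [ipow_prime] removes; a
    factor equal to [P] is cancelled. As the left side depends on the product alone, the
    multiplicity of [P] does not depend on the factorisation. *)
Lemma factorisation_count P s n : prime_ideal P -> nonzero P ->
  (forall P', P' \in s -> prime_ideal P' /\ nonzero P') ->
  (\big[@ideal_mul R/[set: R]]_(J <- s) J `<=` ipow P n <-> (n <= count_mem P s)%N).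
Proof.
move=> pP nP; have /prime_idealP[iP P1 _] := pP.
elim: s n => [|P' s IHs] n hs.
  rewrite big_nil leqn0; split=> [|/eqP -> //]; case: n => // n /(_ 1 I) h.
  by case: P1; exact: (ideal_mul_subl iP h).
have {}IHs m := IHs m (fun J Js => hs J (mem_behead (s := P' :: s) Js)).
have [pP' nP'] := hs P' (mem_head _ _); have /prime_idealP[iP' _ _] := pP'.
rewrite big_cons /=; set Js := \big[_/_]_(_ <- _) _.
have iJs : ideal Js.
  rewrite /Js big_seq; apply: big_ind => // [I J iI _|J Js'].
    exact: ideal_mul_ideal.
  by have [|/prime_idealP[]] := hs J; rewrite ?inE ?Js' ?orbT.
have [->|ne] := eqVneq P' P; last first.
  rewrite add0n -IHs; split=> [h x Jx|h]; last first.
    by apply: subset_trans h; exact: ideal_mul_subr.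
  have [q Pq nq] : exists2 q, P' q & ~ P q.
    apply: contrapT => nq; move/eqP: ne; apply; apply: prime_sub_eq => // q Pq.
    by apply: contrapT => nPq; apply: nq; exists q.
  by apply: (ipow_prime pP nP nq); apply: h; exact: ideal_mul_in.
rewrite add1n; case: n => [|n]; first by split.
rewrite ltnS -IHs; split=> h; last exact: ideal_mulS.
apply: ideal_cancel h => //; exact: ipow_ideal.
Qed.

Lemma factorisation_nonzero I s : nonzero I -> prime_factorisation I s ->
  forall P, P \in s -> prime_ideal P /\ nonzero P.
Proof.
move=> nI [sP sI] P Ps; split; first exact: sP.
apply: nonzeroS nI; rewrite -{}sI; elim: s sP Ps => // J s IHs sP.
rewrite inE big_cons => /orP[/eqP ->|Ps].
  by apply: ideal_mul_subl; have /prime_idealP[] := sP _ (mem_head _ _).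
apply: subset_trans (IHs _ Ps); last by move=> K Ks; apply: sP; rewrite inE Ks orbT.
apply: ideal_mul_subr; rewrite big_seq; apply: big_ind => // [I' J' iI' _|J' Js].
  exact: ideal_mul_ideal.
by have /prime_idealP[] := sP J' (mem_behead (s := J :: s) Js).
Qed.

Lemma ideal_valuationP P x n : prime_ideal P -> x != 0 -> (0 < n)%N ->
  (n <= ideal_valuation P x)%N <-> ipow P n x.
Proof.
move=> pP x0 n0; have iP : ideal P by have /prime_idealP[] := pP.
have nx : nonzero (principal x) by exists x => //; exists 1; rewrite ?mul1r.
have [s fs] := factorisation_exists (principal_ideal x) nx.
have hs := factorisation_nonzero nx fs.
(* The zero ideal is prime too. It occurs in no factorisation of [(x)], and its positive powers do
   not contain [x], so both sides fail. *)
have [nP|zP] := pselect (nonzero P); last first.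
  have z y : P y -> y = 0.
    by move=> Py; apply: contrapT => /eqP y0; apply: zP; exists y.
  split=> [|h]; last first.
    by case/eqP: x0; apply: z; case: n n0 h => // n _; exact: ideal_mul_subl.
  rewrite /ideal_valuation; case: xgetP => [m -> [t ft <-]|_]; last by lia.
  rewrite leqNgt; case/negP; rewrite (leq_ltn_trans _ n0) // leqn0.
  apply/eqP/count_memPn/negP => /(factorisation_nonzero nx ft)[_] //.
have key t : prime_factorisation (principal x) t -> (n <= count_mem P t)%N <-> ipow P n x.
  move=> ft; rewrite -(factorisation_count n pP nP (factorisation_nonzero nx ft)).
  have [_ ->] := ft; split=> [|h _ [y _ <-]]; last by apply: idealM => //; exact: ipow_ideal.
  by apply; exists 1; rewrite ?mul1r.
rewrite /ideal_valuation; case: xgetP => [m -> [t ft <-]|h]; first exact: key.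
by case: (h (count_mem P s)); exists s.
Qed.

Lemma kfreeP k x : (0 < k)%N ->
  kfree k x <-> x != 0 /\ forall P, prime_ideal P -> ~ ipow P k x.
Proof.
move=> k0; split=> -[x0 h]; split=> // P pP.
  by move/(ideal_valuationP pP x0 k0); rewrite leqNgt h.
by rewrite ltnNge; apply/negP => /(ideal_valuationP pP x0 k0); exact: h.
Qed.

End Dedekind.

(** * Primes above a rational prime *)

Lemma Euclid_dvdzM (l : nat) (m n : int) : prime l ->
  (l %| m * n)%Z = (l %| m)%Z || (l %| n)%Z.
Proof. by move=> pl; rewrite !dvdzE abszM Euclid_dvdM. Qed.

Lemma dvdz_int_exists (g n : int) : (g %| n)%Z -> exists c, n = g * c.
Proof. by move=> /dvdzP[c ->]; exists c; rewrite mulrC. Qed.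

Lemma inv_mod_exp (l k : nat) (n : int) : prime l -> ~~ (l %| n)%Z ->
  exists w c, n * w = 1 + l%:Z ^+ k * c.
Proof.
move=> pl ln; have : coprimez n (l%:Z ^+ k).
  by rewrite coprimezE abszX /= coprimeXr // coprime_sym prime_coprime // -dvdzE.
case: (Bezoutz n (l%:Z ^+ k)) => u [v e] /eqP cop; exists u, (- v).
by rewrite cop in e; rewrite -e; ring.
Qed.

Section PrimesAbove.
Variables (R : comNzRingType) (Q : quad_ring R).
Local Notation cj := (cj Q).
Local Notation tau := (tau Q).
Local Notation nu := (nu Q).
Local Notation co := (co Q).
Local Notation nm := (nm Q).
Implicit Types (x y z a b : R) (I J P : set R) (l k : nat) (e : int).

Definition lies_over l P := prime_ideal P /\ P l%:~R.

Lemma lies_over_nonzero l P : prime l -> lies_over l P -> nonzero P.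
Proof.
move=> pl [_ Pl]; exists l%:~R => //; rewrite -(nm_eq0 Q) nm_int.
by rewrite mulf_neq0 //; case: l pl {Pl}.
Qed.

Lemma lies_over_int l P (n : int) : prime l -> lies_over l P -> P n%:~R -> (l %| n)%Z.
Proof.
move=> pl [/prime_idealP[iP P1 _] Pl] Pn; apply: contraT => ln; case: P1.
have [w [c e]] := inv_mod_exp 1 pl ln; rewrite expr1 in e.
have -> : 1 = n%:~R * w%:~R - l%:~R * c%:~R :> R by rewrite -!intrM e; ring.
by apply: idealB => //; exact: idealMright.
Qed.

Lemma lies_over_exists l : prime l -> exists P, lies_over l P.
Proof.
move=> pl; have [||P mP lP] := @maximal_above _ Q (principal l%:~R) (principal_ideal _).
- exists l%:~R; first by exists 1; rewrite ?mul1r.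
  by rewrite -(nm_eq0 Q) nm_int mulf_neq0 //; case: l pl.
- case=> y _ e; suff : (l %| 1)%Z by rewrite dvdz1 /=; case: l pl {e} => [|[]].
  by apply: (@intr_dvd _ Q _ _ y); rewrite mulrC e.
- by exists P; split; [exact: maximal_prime|apply: lP; exists 1; rewrite ?mul1r].
Qed.

Lemma lies_over_some P : prime_ideal P -> nonzero P ->
  exists2 l, prime l & lies_over l P.
Proof.
move=> pP [x Px x0]; have /prime_idealP[iP P1 pP'] := pP.
have [n n0 Pn] : exists2 n : nat, (0 < n)%N & P n%:~R.
  exists `|nm x|%N; first by rewrite absz_gt0 nm_eq0.
  have Pnm : P (nm x)%:~R by rewrite nmE; exact: idealMright.
  have [->//|->] : Posz `|nm x|%N = nm x \/ Posz `|nm x|%N = - nm x by lia.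
  by rewrite intrN; exact: idealN.
elim/ltn_ind: n n0 Pn => n IHn n0 Pn.
have [n1|n1] := leqP n 1.
  by case: P1; have -> : 1 = n%:~R :> R by have -> : n = 1%N by lia.
have pn := pdiv_prime n1; have := divnK (pdiv_dvd n) => e.
have : P ((n %/ pdiv n)%N%:~R * (pdiv n)%:~R) by rewrite -intrM -PoszM e.
case/pP' => h; last by exists (pdiv n).
apply: (IHn _ _ _ h); last by rewrite divn_gt0 ?pdiv_gt0 // dvdn_leq // pdiv_dvd.
by rewrite ltn_Pdiv // prime_gt1.
Qed.

Lemma lies_over_nm l P x : prime l -> lies_over l P -> P x -> (l %| nm x)%Z.
Proof.
move=> pl lP Px; apply: (lies_over_int pl lP); rewrite nmE.
by case: lP => /prime_idealP[iP _ _] _; exact: idealMright.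
Qed.

(** Norms on [P] are divisible by [l]; polarisation then handles the trace, multiplicativity gives
    [l ^ 2] in the norm, and maximality of the order allows division by [l]. *)
Lemma lies_over_mul_cj l P a b : prime l -> lies_over l P -> P a -> P b ->
  exists y, a * cj b = l%:~R * y.
Proof.
move=> pl lP Pa Pb; have /prime_idealP[iP _ _] := lP.1.
apply: (@saturate _ Q); first by case: l pl {lP}.
  by rewrite tr_cjM !rpredB // (lies_over_nm pl lP) //; exact: idealD.
by rewrite nmM nm_cj dvdz_mul // (lies_over_nm pl lP).
Qed.

Lemma lies_over_sqr_nm l P x : prime l -> lies_over l P -> ipow P 2 x ->
  (l%:Z * l%:Z %| nm x)%Z.
Proof.
move=> pl lP; rewrite /ipow /=.
have iP : ideal P by have /prime_idealP[] := lP.1.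
rewrite ideal_mulT // => h.
suff [w e] : exists w, x * cj x = (l%:Z * l%:Z)%:~R * w.
  by apply: (@intr_dvd _ Q _ _ w); rewrite nmE.
(* The two occurrences of [x] in its norm are separated so that each can be expanded as a sum of
   products; a term [a * b * cj (c * d)] gains one factor [l] from [a * cj c] and one from
   [b * cj d]. *)
pose S z y := exists w, z * cj y = (l%:Z * l%:Z)%:~R * w.
suff H z : ideal_mul P P z -> forall y, ideal_mul P P y -> S z y by exact: H.
apply: (@ideal_mul_min _ _ _ [set z | forall y, ideal_mul P P y -> S z y]) => /=.
- by move=> y _; exists 0; rewrite mul0r mulr0.
- move=> u v hu hv y hy; have [w ew] := hu y hy; have [w' ew'] := hv y hy.
  by exists (w + w'); rewrite mulrDl ew ew'; ring.
- move=> a b Pa Pb y; apply: (@ideal_mul_min _ _ _ [set y | S (a * b) y]) => /=.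
  + by exists 0; rewrite rmorph0 !mulr0.
  + move=> u v [w ew] [w' ew'].
    by exists (w + w'); rewrite rmorphD mulrDr ew ew'; ring.
  + move=> c d Pc Pd; have [w ew] := lies_over_mul_cj pl lP Pa Pc.
    have [w' ew'] := lies_over_mul_cj pl lP Pb Pd.
    by exists (w * w'); rewrite rmorphM mulrACA ew ew' intrM; ring.
Qed.

Lemma conjI_lies_over l P : lies_over l P -> lies_over l (conjI Q P).
Proof.
move=> [/prime_idealP[iP P1 pP] Pl]; split; last by rewrite /conjI /= rmorph_int.
apply/prime_idealP; split; first exact: conjI_ideal.
  by rewrite /conjI /= rmorph1.
by move=> u v; rewrite /conjI /= rmorphM; exact: pP.
Qed.

(** By [lies_over_mul_cj], [P'] contains [P * conjI P], hence contains [P] or [conjI P]; non-zero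
    primes are maximal. *)
Lemma lies_over_unique l P P' : prime l -> lies_over l P -> lies_over l P' ->
  P' = P \/ P' = conjI Q P.
Proof.
move=> pl lP lP'; have /prime_idealP[iP' _ pP'] := lP'.1.
have nP := lies_over_nonzero pl lP.
have lPc := conjI_lies_over lP; have nPc := lies_over_nonzero pl lPc.
have [PP'|nPP'] := pselect (P `<=` P').
  by left; rewrite (prime_sub_eq Q lP.1 lP'.1 nP PP').
have [a Pa nP'a] : exists2 a, P a & ~ P' a.
  apply: contrapT => h; apply: nPP' => a Pa.
  by apply: contrapT => nP'a; apply: h; exists a.
right; apply/esym/(prime_sub_eq Q lPc.1 lP'.1 nPc) => b Pb.
have [y] := lies_over_mul_cj pl lP Pa Pb; rewrite cjK => e.
have /pP'[] // : P' (a * b) by rewrite e; apply: idealMright => //; case: lP'.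
Qed.

Lemma ipow_int l P k (m : int) x : lies_over l P -> (l%:Z ^+ k %| m)%Z ->
  ipow P k (m%:~R * x).
Proof.
move=> [/prime_idealP[iP _ _] Pl] /dvdz_int_exists[c ->].
rewrite intrM rmorphXn /= -mulrA; apply: idealMright; first exact: ipow_ideal.
exact: ipowX.
Qed.

(** * Split primes and residues modulo powers of degree-one primes *)

Definition phi e x : int := (co x).1 + (co x).2 * e.

(** The minimal polynomial of [dl], evaluated at [e]. Substituting [e] for [dl], which is [phi e],
    is a ring morphism modulo this integer. *)
Definition qform e : int := e * e - tau * e + nu.

(** [e] is a root of the minimal polynomial of [dl] modulo [l ^ k], and a simple one modulo [l].
    Then [x |-> phi e x] and [x |-> phi e (cj x)] are the reductions modulo the [k]-th powers of the
    two primes above [l]. *)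
Definition split_prime l k e :=
  [/\ prime l, (0 < k)%N, (l%:Z ^+ k %| qform e)%Z & ~~ (l %| 2 * e - tau)%Z].

Lemma co_dl : co (dl Q) = (0, 1).
Proof. by rewrite -[RHS](@co_pt _ Q); congr co; ring. Qed.

Lemma coM x y : co (x * y) =
  ((co x).1 * (co y).1 - nu * (co x).2 * (co y).2,
   (co x).1 * (co y).2 + (co x).2 * (co y).1 + tau * (co x).2 * (co y).2).
Proof.
have dd : dl Q * dl Q = tau%:~R * dl Q - nu%:~R.
  by rewrite -(dl_cj Q) cj_dl; ring.
rewrite -{1}(coK Q x) -{1}(coK Q y) -[RHS](@co_pt _ Q); congr co.
transitivity ((co x).1%:~R * (co y).1%:~R +
    ((co x).1%:~R * (co y).2%:~R + (co x).2%:~R * (co y).1%:~R) * dl Q +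
    (co x).2%:~R * (co y).2%:~R * (dl Q * dl Q)); first by ring.
by rewrite dd; ring.
Qed.

Lemma co_cj x : co (cj x) = ((co x).1 + tau * (co x).2, - (co x).2).
Proof. by rewrite cjE -[RHS](@co_pt _ Q); congr co; ring. Qed.

Lemma phi_pt e m : phi e (pt Q m) = m.1 + m.2 * e.
Proof. by rewrite /phi ptK. Qed.

Lemma phiD e x y : phi e (x + y) = phi e x + phi e y.
Proof. by rewrite /phi coD /=; ring. Qed.

Lemma phiN e x : phi e (- x) = - phi e x.
Proof. by rewrite /phi coN /=; ring. Qed.

Lemma phiB e x y : phi e (x - y) = phi e x - phi e y.
Proof. by rewrite phiD phiN. Qed.

Lemma phi_int e n : phi e n%:~R = n.
Proof. by rewrite /phi co_int /=; ring. Qed.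

Lemma phiZ e n x : phi e (n%:~R * x) = n * phi e x.
Proof. by rewrite /phi coZ /=; ring. Qed.

Lemma phiM e x y : phi e (x * y) = phi e x * phi e y - (co x).2 * (co y).2 * qform e.
Proof. by rewrite /phi coM /qform /=; ring. Qed.

Lemma nm_phi e x : nm x = phi e x * phi e (cj x) + (co x).2 * (co x).2 * qform e.
Proof. by rewrite /nm /phi co_cj /qform /=; ring. Qed.

Lemma phi_dvd_nm (q : int) e x : (q %| qform e)%Z -> (q %| phi e x)%Z -> (q %| nm x)%Z.
Proof. by move=> qe qx; rewrite (nm_phi e); apply: rpredD; [exact: dvdz_mulr|exact: dvdz_mull]. Qed.

(** Chinese remainders for the two primes above [l]: the two residues of [x] differ by
    [(co x).2 * (2 * e - tau)], and [2 * e - tau] is invertible modulo [l ^ k]. *)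
Lemma phi_onto l k e (u v : int) : split_prime l k e ->
  exists x, phi e x = u /\ (l%:Z ^+ k %| phi e (cj x) - v)%Z.
Proof.
move=> [pl _ _ ln]; have [w [c ew]] := inv_mod_exp k pl ln.
exists ((u - w * (u - v) * e)%:~R + (w * (u - v))%:~R * dl Q).
rewrite /phi co_cj co_pt /=; split; first by ring.
have -> : u - w * (u - v) * e + tau * (w * (u - v)) + - (w * (u - v)) * e - v =
   (u - v) - (2 * e - tau) * w * (u - v) by ring.
by rewrite ew; apply/dvdzP; exists (- c * (u - v)); ring.
Qed.

Definition phi_prime l e : set R := [set x | (l %| phi e x)%Z].

Lemma split_dvd_qform l k e : split_prime l k e -> (l %| qform e)%Z.
Proof.
move=> [_ k0 h _]; apply: dvdz_trans h.
by case: k k0 => // k _; rewrite exprS dvdz_mulr.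
Qed.

Lemma phi_lies_over l k e : split_prime l k e -> lies_over l (phi_prime l e).
Proof.
move=> spl; have le := split_dvd_qform spl; have [pl _ _ _] := spl.
split; last by rewrite /phi_prime /= phi_int.
apply/prime_idealP; split.
- split; rewrite /phi_prime /=.
  + by rewrite -[0]/(0%:~R) phi_int.
  + by move=> x y lx ly; rewrite phiD rpredD.
  + by move=> x y ly; rewrite phiM rpredB // ?dvdz_mull.
- rewrite /phi_prime /= -[1]/(1%:~R) phi_int dvdz1 /=.
  by case: l pl {spl le} => [|[]].
- move=> u v; rewrite /phi_prime /= phiM rpredBr; last exact: dvdz_mull.
  by rewrite Euclid_dvdzM // => /orP.
Qed.

(** Modulo [l ^ k], [x] is a multiple of [dl - e]. The norm of [dl - e] is [qform e], divisible by
    [l ^ k], while its conjugate is outside the prime, so the whole power divides [dl - e]. *)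
Lemma phi_ipow l k e x : split_prime l k e -> (l%:Z ^+ k %| phi e x)%Z ->
  ipow (phi_prime l e) k x.
Proof.
move=> spl qx; have lP := phi_lies_over spl; have [pl _ le ln] := spl.
have /prime_idealP[iP _ _] := lP.1.
have -> : x = (phi e x)%:~R * 1 + (co x).2%:~R * (dl Q - e%:~R).
  by rewrite -{1}(coK Q x) /phi; ring.
apply: idealD; [exact: ipow_ideal|exact: (ipow_int _ lP)|].
apply: idealM; first exact: ipow_ideal.
have np : ~ phi_prime l e (cj (dl Q - e%:~R)).
  rewrite /phi_prime /= rmorphB rmorph_int cj_dl !phiB !phi_int.
  have -> : phi e (dl Q) = e by rewrite /phi co_dl /=; ring.
  by move=> h; case/negP: ln; rewrite -rpredN; have -> : - (2 * e - tau) = tau - e - e by ring.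
apply: (ipow_prime Q lP.1 _ np); first exact: lies_over_nonzero lP.
rewrite mulrC -nmE -[_%:~R]mulr1; apply: ipow_int lP _.
have -> // : nm (dl Q - e%:~R) = qform e.
by rewrite /nm coB co_int co_dl /qform /=; ring.
Qed.

Lemma split_not_kfree l k e x : split_prime l k e -> (l%:Z ^+ k %| phi e x)%Z ->
  ~ kfree k x.
Proof.
move=> spl qx /(kfreeP Q)[|_ /(_ (phi_prime l e))]; first by case: spl.
by case: (phi_lies_over spl) => pP _ /(_ pP); apply; exact: phi_ipow.
Qed.

Lemma ipow_phi l k e x : split_prime l k e -> ipow (phi_prime l e) k x ->
  (l%:Z ^+ k %| phi e x)%Z.
Proof.
move=> [_ _]; elim: k x => [|k IHk] x qe ln; first by rewrite expr0 dvd1z.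
have qe' : (l%:Z ^+ k %| qform e)%Z.
  by apply: dvdz_trans qe; rewrite exprS dvdz_mull.
apply: (@ideal_mul_min _ _ _ [set x | (l%:Z ^+ k.+1 %| phi e x)%Z]) => /=.
- by rewrite -[0]/(0%:~R) phi_int.
- by move=> u v hu hv; rewrite phiD rpredD.
- move=> a b la kb; rewrite phiM rpredB //; last by rewrite dvdz_mull.
  by rewrite exprS dvdz_mul // IHk.
Qed.

Lemma ipow_conjI P k x : ipow (conjI Q P) k x -> ipow P k (cj x).
Proof.
elim: k x => [|k IHk] x //=.
apply: (@ideal_mul_min _ _ _ [set x | ideal_mul P (ipow P k) (cj x)]) => /=.
- by rewrite rmorph0; exact: ideal_mul0.
- by move=> u v; rewrite rmorphD; exact: ideal_mulD.
- by move=> a b Pa /IHk Pb; rewrite rmorphM; exact: ideal_mul_in.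
Qed.

Lemma split_ipow_phi l k e P x : split_prime l k e -> lies_over l P -> ipow P k x ->
  (l%:Z ^+ k %| phi e x)%Z \/ (l%:Z ^+ k %| phi e (cj x))%Z.
Proof.
move=> spl lP; have [pl _ _ _] := spl.
have [->|->] := lies_over_unique pl (phi_lies_over spl) lP.
  by left; exact: ipow_phi.
by move/ipow_conjI; right; exact: ipow_phi.
Qed.

Lemma hensel l k e : split_prime l k e -> exists e', split_prime l k.+1 e'.
Proof.
move=> spl; have [pl k0 /dvdz_int_exists[u eu] ln] := spl.
have [w [c]] := inv_mod_exp 1 pl ln; rewrite expr1 => ew.
have [j ek] : exists j, k = j.+1 by exists k.-1; rewrite prednK.
(* Newton step: [w] inverts the derivative [2 * e - tau] modulo [l], so [h * z] cancels [qform e]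
   modulo [l ^ (k + 1)]. The quadratic term is absorbed because [k] is positive. *)
pose h := l%:Z ^+ k; pose z := - (u * w).
have eh : h = l%:Z * l%:Z ^+ j by rewrite /h ek exprS.
exists (e + h * z); split=> //.
  apply/dvdzP; exists (l%:Z ^+ j * z * z - u * c).
  have -> : qform (e + h * z) = qform e + h * (2 * e - tau) * z + h * h * z * z.
    by rewrite /qform; ring.
  rewrite eu -/h exprS -/h.
  have -> : h * (2 * e - tau) * z = - h * u * ((2 * e - tau) * w) by rewrite /z; ring.
  by rewrite ew {3}eh; ring.
have -> : 2 * (e + h * z) - tau = (2 * e - tau) + l%:Z * (2 * l%:Z ^+ j * z).
  by rewrite eh; ring.
by rewrite rpredDr // dvdz_mulr.
Qed.

(** An argument in the style of Euclid. At [nu * E] the polynomial [qform] equals [nu * g] with [g]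
    congruent to 1 modulo [E], so a prime factor [l] of [g] does not divide [E]. The factorial in
    [E] makes [l] exceed [B]; the discriminant in [E], a square of [2 * e - tau] modulo [l], makes
    the root simple. [hensel] raises the exponent. *)
Lemma split_prime_exists (B k : nat) : (0 < k)%N -> exists l e, (B < l)%N /\ split_prime l k e.
Proof.
move=> k0; suff [l [e [Bl spl]]] : exists l e, (B < l)%N /\ split_prime l 1 e.
  case: k k0 => // k _; exists l.
  suff [e' spl'] : exists e', split_prime l k.+1 e' by exists e'.
  by elim: k => [|k [e' /hensel]]; first by exists e.
have aniso := @form_aniso _ Q.
have D0 : tau * tau - 4 * nu != 0.
  apply/eqP => h; have [|_ //] := aniso tau (- 2).
  by transitivity (- (tau * tau - 4 * nu)); [ring|rewrite h].
have nu0 : nu != 0.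
  by apply/eqP => h; have [|_ //] := aniso 0 1; rewrite h; ring.
(* The margin makes both [E] and [nu * E - tau] at least 3 in absolute value, so that [g] has a
   prime factor. *)
pose B' := (B + `|tau|%N + 3)%N.
pose E : int := (tau * tau - 4 * nu) * B'`!%:Z.
pose g := nu * E * E - tau * E + 1.
have leE : (B' <= `|E|)%N.
  rewrite /E abszM absz_nat (leq_trans (_ : B' <= B'`!)%N) //.
    by elim: (B') => // n IHn; rewrite factS leq_pmulr // fact_gt0.
  by rewrite leq_pmull // absz_gt0.
have g1 : (1 < `|g|)%N.
  have : (3 <= `|(nu * E - tau)%R|)%N.
    have : (`|E| <= `|(nu * E)%R|)%N by rewrite abszM leq_pmull // absz_gt0.
    by rewrite /B' in leE; lia.
  have -> : g = E * (nu * E - tau) + 1 by rewrite /g; ring.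
  move=> h; have : (3 * 3 <= `|(E * (nu * E - tau))%R|)%N.
    by rewrite abszM leq_mul //; rewrite /B' in leE; lia.
  by lia.
have pl := pdiv_prime g1; set l := pdiv _ in pl.
have lg : (l %| g)%Z by rewrite dvdzE pdiv_dvd.
have lE : ~~ (l %| E)%Z.
  apply/negP => lE; have : (l %| 1)%Z.
    have e1 : g - (nu * E - tau) * E = 1%Z by rewrite /g; ring.
    by rewrite -e1 rpredB // dvdz_mull.
  by rewrite dvdz1 /=; case: (l) pl => [|[]].
exists l, (nu * E); split.
  rewrite ltnNge; apply: contra lE => lB.
  rewrite /E dvdz_mull // dvdzE absz_nat dvdn_fact // prime_gt0 //=.
  by rewrite (leq_trans lB) // /B' -addnA leq_addr.
have lq : (l %| qform (nu * E))%Z.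
  have -> : qform (nu * E) = nu * g by rewrite /qform /g; ring.
  exact: dvdz_mull.
split=> //.
apply: contra lE => h; rewrite /E dvdz_mulr //.
have -> : tau * tau - 4 * nu = (2 * (nu * E) - tau) * (2 * (nu * E) - tau) -
   4 * qform (nu * E) by rewrite /qform; ring.
by rewrite rpredB // dvdz_mull.
Qed.

End PrimesAbove.

(** * Sieve *)

(** Telescoping comparison of [1 / l ^ 2] with [1 / (l - 1) - 1 / l]. *)
Lemma sum_inv_sqr (N B : nat) : (0 < N)%N -> (N <= B)%N ->
  \sum_(N.+1 <= l < B.+1) (l%:R ^- 2) <= N%:R^-1 - B%:R^-1 :> rat.
Proof.
move=> N0 /subnK <-; elim: (B - N)%N => [|i IHi].
  by rewrite add0n big_geq // subrr.
rewrite addSn big_nat_recr /=; last by lia.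
set b := (i + N)%N in IHi *; have b0 : 0 < b%:R :> rat by rewrite ltr0n; lia.
apply: (le_trans (lerD IHi (lexx _))).
suff : b.+1%:R ^- 2 <= b%:R^-1 - b.+1%:R^-1 :> rat.
  by move: (b.+1%:R ^- 2) (b.+1%:R^-1) (b%:R^-1) (N%:R^-1) => p q r s; lra.
have -> : b%:R^-1 - b.+1%:R^-1 = (b%:R * b.+1%:R)^-1 :> rat.
  by rewrite -natr1; field; rewrite ?natr1 !pnatr_eq0; lia.
by rewrite lef_pV2 ?posrE -?natrX -?natrM ?ltr0n ?ler_nat; lia.
Qed.

(** Each term is at most [4 * (C * L) ^ 2 / l ^ 2 + 4]. The first parts sum to at most
    [4 * (C * L) ^ 2 / N], which the factor 8 in the bound on [N] turns into half of [L ^ 2] after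
    multiplication by [n]. The rest grows only linearly in [L], and [L] is chosen to keep it below
    the other half. *)
Lemma sieve_arith (n N C H m L : nat) : (0 < N)%N -> (8 * n * C * C <= N)%N ->
  L = (2 * n * (1 + 4 * C * (H + m))).+1 ->
  (n * (1 + \sum_(N.+1 <= l < (C * (H + m * L)).+1) 2 * (C * L %/ l + 1) ^ 2) < L * L)%N.
Proof.
move=> N0 hN eL; set B := (C * _)%N.
have cl l : (N < l)%N -> (2 * (C * L %/ l + 1) ^ 2)%:R <=
    4 * (C * L)%:R ^+ 2 * l%:R ^- 2 + 4 :> rat.
  move=> Nl; set q := (_ %/ l)%N; rewrite natrM natrX natrD.
  have l0 : 0 < l%:R :> rat by rewrite ltr0n; lia.
  have hq : q%:R <= (C * L)%:R / l%:R :> rat.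
    by rewrite ler_pdivlMr // -natrM ler_nat leq_trunc_div.
  have q0 : 0 <= q%:R :> rat by rewrite ler0n.
  set u := (C * L)%:R / l%:R in hq.
  have -> : 4 * (C * L)%:R ^+ 2 * l%:R ^- 2 = 4 * u ^+ 2 :> rat.
    by rewrite /u expr_div_n; ring.
  have qu : q%:R ^+ 2 <= u ^+ 2 by rewrite lerXn2r ?nnegrE // (le_trans q0 hq).
  have := sqr_ge0 (q%:R - 1 : rat).
  move: (q%:R : rat) (u ^+ 2) qu => p w qu.
  have -> : (p - 1) ^+ 2 = p ^+ 2 - 2 * p + 1 by ring.
  have -> : 2 * (p + 1) ^+ 2 = 2 * p ^+ 2 + 4 * p + 2 by ring.
  by lra.
have [BN|NB] := leqP B N.
  rewrite big_geq ?ltnS // addn0 muln1 eL; nia.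
rewrite -(ltr_nat rat) natrM natrD natr_sum.
have hs : \sum_(N.+1 <= l < B.+1) (2 * (C * L %/ l + 1) ^ 2)%:R <=
    4 * (C * L)%:R ^+ 2 * N%:R^-1 + 4 * B%:R :> rat.
  apply: (@le_trans _ _ (\sum_(N.+1 <= l < B.+1) (4 * (C * L)%:R ^+ 2 * l%:R ^- 2 + 4))).
    rewrite big_nat_cond [leRHS]big_nat_cond; apply: ler_sum => l.
    by rewrite andbT => /andP[Nl _]; exact: cl.
  rewrite big_split /= -mulr_sumr lerD //.
    rewrite ler_wpM2l ?mulr_ge0 ?exprn_ge0 ?ler0n //.
    apply: (le_trans (sum_inv_sqr N0 (ltnW NB))).
    by rewrite lerBlDr lerDl invr_ge0 ler0n.
  by rewrite sumr_const_nat -[leLHS]mulr_natr ler_wpM2l ?ler0n // ler_nat; lia.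
have n0 : 0 <= n%:R :> rat by rewrite ler0n.
apply: (le_lt_trans (ler_wpM2l n0 (lerD (lexx 1%:R) hs))).
have N0' : 0 < N%:R :> rat by rewrite ltr0n.
have hN' : 8 * n%:R * C%:R * C%:R <= N%:R :> rat by rewrite -!natrM ler_nat.
have h1 : n%:R * (4 * (C * L)%:R ^+ 2 * N%:R^-1) <= L%:R * L%:R / 2 :> rat.
  rewrite mulrA ler_pdivrMr // natrM.
  have -> : n%:R * (4 * (C%:R * L%:R) ^+ 2) = (8 * n%:R * C%:R * C%:R) * (L%:R * L%:R / 2) :> rat.
    by field.
  by rewrite mulrC ler_wpM2l // divr_ge0 // mulr_ge0.
have h2 : (2 * (n * (1 + 4 * B)) < L * L)%N.
  rewrite /B; have : (n * (1 + 4 * (C * (H + m * L))) <= n * (1 + 4 * C * (H + m)) * L)%N.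
    have L1 : (1 <= L)%N by rewrite eL.
    by rewrite -mulnA leq_mul2l; apply/orP; right; nia.
  move=> h; apply: (leq_ltn_trans (leq_mul (leqnn 2) h)).
  rewrite mulnA ltn_pmul2r ?eL; lia.
have : 2 * (n%:R * (1 + 4 * B%:R)) < L%:R * L%:R :> rat.
  by move: h2; generalize B => b; rewrite -(ltr_nat rat) !natrM natrD natrM.
move=> h3; rewrite [ltRHS]natrM; move: h1 h3; set T := _ / N%:R; rewrite !mulrDr.
by move: (n%:R * T) (L%:R * L%:R) => p q; lra.
Qed.

(** Pigeonhole: the grid is cut into cells of side [l / C], each holding at most one point of
    [W]. *)
Lemma card_spaced (L C l : nat) (W : pred ('I_L * 'I_L)) : (0 < l)%N ->
  (forall z z', W z -> W z' ->
    (C * `|z.1%:Z - z'.1%:Z| < l)%N -> (C * `|z.2%:Z - z'.2%:Z| < l)%N -> z = z') ->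
  (#|W| <= (C * L %/ l + 1) ^ 2)%N.
Proof.
move=> l0 hW; set q := (C * L %/ l)%N.
have hq (i : 'I_L) : (C * i %/ l < q.+1)%N.
  by rewrite ltnS leq_div2r // leq_mul2l ltnW ?orbT.
pose f (z : 'I_L * 'I_L) := (inord (C * z.1 %/ l) : 'I_q.+1, inord (C * z.2 %/ l) : 'I_q.+1).
have close (i j : 'I_L) : inord (C * i %/ l) = inord (C * j %/ l) :> 'I_q.+1 ->
    (C * `|i%:Z - j%:Z| < l)%N.
  move=> /(congr1 val); rewrite /= !inordK // => e.
  have := divn_eq (C * i) l; have := divn_eq (C * j) l; rewrite e.
  have := ltn_pmod (C * i) l0; have := ltn_pmod (C * j) l0.
  move: (_ %% _)%N (_ %% _)%N (_ %/ _ * _)%N => a b c; nia.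
rewrite -(@card_in_imset _ _ f); last first.
  by move=> z z' Wz Wz' [/close h1 /close h2]; exact: hW.
apply: (leq_trans (max_card _)).
by rewrite card_prod !card_ord addn1 mulnn.
Qed.

Lemma prime_dvd_fact (l n : nat) : prime l -> (l %| n`!)%N -> (l <= n)%N.
Proof.
move=> pl; elim: n => [|n IHn]; first by rewrite fact0 dvdn1 => /eqP l1; rewrite l1 in pl.
by rewrite factS Euclid_dvdM // => /orP[/dvdn_leq -> //|/IHn/leqW].
Qed.

Lemma PoszX (l k : nat) : Posz (l ^ k)%N = l%:Z ^+ k.
Proof. by rewrite -!natz natrX. Qed.

Section Sieve.
Variables (R : comNzRingType) (Q : quad_ring R) (k : nat).
Hypothesis k2 : (2 <= k)%N.
Local Notation tau := (tau Q).
Local Notation nu := (nu Q).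
Local Notation co := (co Q).
Local Notation pt := (pt Q).
Local Notation nm := (nm Q).
Implicit Types (x y z t : R) (P : set R).

Definition cform : nat := (1 + `|tau| + `|nu|)%N.

Lemma nm_le x (M : nat) : (`|(co x).1| <= M)%N -> (`|(co x).2| <= M)%N ->
  (`|nm x| <= cform * M * M)%N.
Proof.
rewrite /nm /cform; move: (co x).1 (co x).2 => a b ha hb.
have h1 : (`|(a * a)%R| <= M * M)%N by rewrite abszM leq_mul.
have h2 : (`|(tau * a * b)%R| <= `|tau| * M * M)%N by rewrite !abszM !leq_mul.
have h3 : (`|(nu * b * b)%R| <= `|nu| * M * M)%N by rewrite !abszM !leq_mul.
have -> : ((1 + `|tau| + `|nu|) * M * M = M * M + `|tau| * M * M + `|nu| * M * M)%N by ring.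
move: (a * a) (tau * a * b) (nu * b * b) (M * M)%N (`|tau| * M * M)%N (`|nu| * M * M)%N h1 h2 h3.
by move=> p q r u v w; lia.
Qed.

(** If [M] is the larger absolute coordinate, the norm is at most [cform * M ^ 2], hence at most
    [(cform * M) ^ 2 < l ^ 2], whereas [l ^ 2] divides it. *)
Lemma spacing (l : nat) P x : prime l -> lies_over l P -> ipow P 2 x ->
  (cform * `|(co x).1| < l)%N -> (cform * `|(co x).2| < l)%N -> x = 0.
Proof.
move=> pl lP Px h1 h2; apply/eqP; rewrite -(nm_eq0 Q); apply: contraT => n0.
have := lies_over_sqr_nm Q pl lP Px; rewrite dvdzE abszM /= => /dvdn_leq.
rewrite absz_gt0 n0 => /(_ isT); rewrite leqNgt => /negP[].
pose M := maxn `|(co x).1| `|(co x).2|.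
apply: (leq_ltn_trans (nm_le (leq_maxl _ _) (leq_maxr _ _))); rewrite -/M.
have hM : (cform * M < l)%N by rewrite /M /maxn; case: ifP.
have C1 : (0 < cform)%N by rewrite /cform.
by move: hM C1; move: cform M => c M; nia.
Qed.

Lemma lies_over_mod l P (m : int) x y : lies_over l P -> (l%:Z ^+ k %| m)%Z ->
  ipow P k (x + m%:~R * y) -> ipow P k x.
Proof.
move=> lP lm h; have iP : ideal P by have /prime_idealP[] := lP.1.
rewrite -(addrK (m%:~R * y) x); apply: idealB => //; first exact: ipow_ideal.
exact: (ipow_int _ lP).
Qed.

(** Progressions modulo [m] already settle the primes dividing [m], so a failure must come from
    another prime. It is recorded with exponent 2, the one for which [spacing] is available. *)
Lemma not_kfree_over (m : nat) x : (0 < m)%N ->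
  (forall l, prime l -> (l %| m)%N -> (l ^ k %| m)%N) ->
  (forall l P, prime l -> (l %| m)%N -> lies_over l P -> ~ ipow P k x) ->
  forall y, let z := x + m%:~R * y in
  ~ kfree k z -> z = 0 \/ exists l P, [/\ prime l, ~~ (l %| m)%N, lies_over l P & ipow P 2 z].
Proof.
move=> m0 mk hx y z nk; have [->|z0] := eqVneq z 0; [by left|right].
have [P pP zP] : exists2 P, prime_ideal P & ipow P k z.
  apply: contrapT => h; apply: nk; apply/(kfreeP Q); first lia.
  by split=> // P pP zP; apply: h; exists P.
have iP : ideal P by have /prime_idealP[] := pP.
have nP : nonzero P.
  exists z => //; case: (k) k2 zP => // k' _.
  exact: ideal_mul_subl.
have [l pl lP] := lies_over_some Q pP nP; exists l, P; split=> //; last exact: ipow_le zP.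
apply/negP => lm; apply: (hx l P pl lm lP); apply: (lies_over_mod lP _ zP).
by rewrite dvdzE abszX; exact: mk.
Qed.

(** If every [y] of an [L] by [L] box were bad, the box would be covered by the zeros of the
    [a + t + m * y] and by the positions lying in some [P ^ 2] over a prime larger than [N].
    [sieve_arith] shows that these are fewer than [L * L]. *)
Lemma sieve_mod (A : seq R) (N m : nat) (t : R) : (0 < N)%N ->
  (8 * size A * cform * cform <= N)%N -> (0 < m)%N ->
  (forall l, prime l -> (l <= N)%N -> (l %| m)%N) ->
  (forall l, prime l -> (l %| m)%N -> (l ^ k %| m)%N) ->
  (forall l P a, prime l -> (l %| m)%N -> lies_over l P -> a \in A -> ~ ipow P k (a + t)) ->
  exists y, forall a, a \in A -> kfree k (a + (t + m%:~R * y)).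
Proof.
move=> N0 hN m0 mN mk hA; apply: contrapT => bad.
pose n := size A; pose C := cform.
(* [H] bounds the coordinates of every [a + t]; [B] bounds the primes that can spoil a translate
   taken from the box. *)
pose H := (\sum_(a <- A) (`|(co (a + t)).1| + `|(co (a + t)).2|))%N.
pose L := (2 * n * (1 + 4 * C * (H + m))).+1.
pose B := (C * (H + m * L))%N.
pose x (i : nat) (z : 'I_L * 'I_L) : R := A`_i + t + m%:~R * pt (z.1%:Z, z.2%:Z).
(* One prime above [l]; with its conjugate it exhausts them. The default value never counts, because
   [W] also asks for [lies_over]. *)
pose Pl l : set R := xget set0 [set P | lies_over l P].
have Plh l P : prime l -> lies_over l P -> lies_over l (Pl l).
  by move=> pl lP; rewrite /Pl; case: xgetP => [P' -> //|/(_ P)]; case.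
pose Plb l (b : bool) := if b then Pl l else conjI Q (Pl l).
pose W (i l : nat) (b : bool) (z : 'I_L * 'I_L) : bool :=
  `[< [/\ prime l, ~~ (l %| m)%N, lies_over l (Plb l b) & ipow (Plb l b) 2 (x i z)] >].
have co_diff (z z' : 'I_L * 'I_L) : co (pt (z.1%:Z, z.2%:Z) - pt (z'.1%:Z, z'.2%:Z)) = 
    (z.1%:Z - z'.1%:Z, z.2%:Z - z'.2%:Z).
  by rewrite coB !ptK.
have hW i l b : (#|W i l b| <= (C * L %/ l + 1) ^ 2)%N.
  have [l0|l0] := posnP l.
    rewrite (_ : #|_| = 0)%N //; apply: eq_card0 => z; apply/negbTE/negP.
    by move=> /asboolP[]; rewrite l0.
  apply: card_spaced => // z z' /asboolP[pl lm lP Wz] /asboolP[_ _ _ Wz'] h1 h2.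
  have iP : ideal (Plb l b) by have /prime_idealP[] := lP.1.
  have : ipow (Plb l b) 2 (x i z - x i z') by apply: idealB => //; exact: ipow_ideal.
  have -> : x i z - x i z' = m%:~R * (pt (z.1%:Z, z.2%:Z) - pt (z'.1%:Z, z'.2%:Z)).
    by rewrite /x; ring.
  have nPm : ~ Plb l b m%:~R.
    move=> Pm; case/negP: lm; rewrite -[(_ %| _)%N]/(l%:Z %| m%:Z)%Z.
    exact: lies_over_int Pm.
  move=> /(ipow_prime Q lP.1 (lies_over_nonzero Q pl lP) nPm)/(spacing pl lP).
  rewrite co_diff /= => /(_ h1 h2)/eqP; rewrite subr_eq0 => /eqP/(can_inj (@ptK _ Q)).
  by case: z z' {Wz Wz' h1 h2} => [z1 z2] [w1 w2] /= [] e1 e2; congr pair; apply: val_inj.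
pose Z i (z : 'I_L * 'I_L) := x i z == 0.
have hZ i : (#|Z i| <= 1)%N.
  apply/card_le1_eqP => z z' /= /eqP e1 /eqP e2.
  have : m%:~R * pt (z.1%:Z, z.2%:Z) = m%:~R * pt (z'.1%:Z, z'.2%:Z) :> R.
    by apply: (addrI (A`_i + t)); rewrite -!/(x i _) e1 e2.
  have m0' : m%:Z != 0 by lia.
  move=> /(intr_mulI Q m0')/(can_inj (@ptK _ Q)).
  by case: z z' {e1 e2} => [z1 z2] [w1 w2] /= [] e1 e2; congr pair; apply: val_inj.
have cover (z : 'I_L * 'I_L) : (1 <= \sum_(i < n) (Z i z +
    \sum_(N.+1 <= l < B.+1) (W i l true z + W i l false z)))%N.
  have [a [aA nk]] : exists a, a \in A /\
     ~ kfree k (a + t + m%:~R * pt (z.1%:Z, z.2%:Z)).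
    apply: contrapT => h; apply: bad; exists (pt (z.1%:Z, z.2%:Z)) => a aA.
    by apply: contrapT => h'; apply: h; exists a; split=> //; rewrite -addrA.
  have ia : (index a A < n)%N by rewrite index_mem.
  rewrite (bigD1 (Ordinal ia)) //=; apply: leq_trans (leq_addr _ _).
  have ex : x (index a A) z = a + t + m%:~R * pt (z.1%:Z, z.2%:Z) by rewrite /x nth_index.
  have [|e0|[l [P [pl lm lP]]]] := not_kfree_over m0 mk _ nk.
  - by move=> l P pl lm lP; exact: (hA l P a pl lm lP aA).
  - by rewrite /Z ex e0 eqxx.
  rewrite -ex => Pz.
  rewrite {1}/Z; have [//|z0] := eqVneq (x (index a A) z) 0.
  (* Beyond [B] a non-zero point with such coordinates would contradict [spacing]. *)
  have lB : (l < B.+1)%N.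
    rewrite ltnS leqNgt; apply/negP => Bl; move/eqP: z0; apply; apply: (spacing pl lP Pz).
      apply: leq_ltn_trans Bl; rewrite /B -/C leq_mul2l; apply/orP; right.
      rewrite ex coD coZ ptK /= (leq_trans (_ : _ <= `|(co (a + t)).1| + m * z.1)%N) //.
        lia.
      rewrite leq_add ?leq_mul2l ?(ltnW (ltn_ord _)) ?orbT // /H (big_rem a) //=.
      by lia.
    apply: leq_ltn_trans Bl; rewrite /B -/C leq_mul2l; apply/orP; right.
    rewrite ex coD coZ ptK /= (leq_trans (_ : _ <= `|(co (a + t)).2| + m * z.2)%N) //.
      lia.
    rewrite leq_add ?leq_mul2l ?(ltnW (ltn_ord _)) ?orbT // /H (big_rem a) //=.
    by lia.
  have Nl : (N < l)%N by rewrite ltnNge; apply/negP => /(mN l pl); exact/negP.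
  rewrite add0n (bigD1_seq l) ?iota_uniq //=; last by rewrite mem_index_iota Nl.
  apply: leq_trans (leq_addr _ _).
  have lPl := Plh l P pl lP.
  have [eP|eP] := lies_over_unique Q pl lPl lP.
    suff -> : W (index a A) l true z by [].
    by apply/asboolP; rewrite /Plb -eP.
  suff -> : W (index a A) l false z by rewrite addn1.
  by apply/asboolP; rewrite /Plb -eP.
suff : (L * L < L * L)%N by rewrite ltnn.
have := @sieve_arith n N C H m L N0 hN erefl; apply: leq_ltn_trans.
have -> : (L * L = \sum_(z : 'I_L * 'I_L) 1)%N by rewrite sum1_card card_prod card_ord.
apply: (@leq_trans (\sum_(z : 'I_L * 'I_L) \sum_(i < n) (Z i z +
    \sum_(N.+1 <= l < B.+1) (W i l true z + W i l false z)))%N).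
  by apply: leq_sum => z _; exact: cover.
rewrite exchange_big /= -[n in (n * _)%N]card_ord -sum_nat_const.
apply: leq_sum => i _; rewrite big_split /= leq_add //.
  by rewrite -big_mkcond /= sum1_card; exact: hZ.
rewrite exchange_big /=; apply: leq_sum => l _.
by rewrite big_split /= mul2n -addnn leq_add // -big_mkcond /= sum1_card; exact: hW.
Qed.

(** Each [e] of [E] receives its own new prime [l], dividing neither [m] nor any norm of [a - e].
    The class of [t] is refined so that [e + t] becomes divisible by [l ^ k]; each [a + t] is then
    congruent to [a - e], which is outside the primes above [l]. The list [E] is not sieved, so [N]
    depends on [A] alone. *)
Lemma sieve_sep (A E : seq R) (N m : nat) (t : R) : (0 < N)%N ->
  (8 * size A * cform * cform <= N)%N -> (0 < m)%N ->
  (forall l, prime l -> (l <= N)%N -> (l %| m)%N) ->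
  (forall l, prime l -> (l %| m)%N -> (l ^ k %| m)%N) ->
  (forall l P a, prime l -> (l %| m)%N -> lies_over l P -> a \in A -> ~ ipow P k (a + t)) ->
  (forall e, e \in E -> e \notin A) ->
  exists y, (forall a, a \in A -> kfree k (a + (t + m%:~R * y))) /\
    forall e, e \in E -> ~ kfree k (e + (t + m%:~R * y)).
Proof.
move=> N0 hN; elim: E m t => [|e E IHE] m t m0 mN mk hA hE.
  by have [y hy] := sieve_mod N0 hN m0 mN mk hA; exists y.
have eA : e \notin A by apply: hE; rewrite inE eqxx.
have [l] := prime.prime_above (m + \sum_(a <- A) `|nm (a - e)|)%N; move=> l_big pl.
have lm : ~~ (l %| m)%N by apply/negP => /(dvdn_leq m0); lia.
have lA a : a \in A -> ~~ (l %| nm (a - e))%Z.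
  move=> aA; apply/negP; rewrite dvdzE /= => /dvdn_leq; rewrite absz_gt0 nm_eq0 subr_eq0.
  have ae : a != e by apply: contraNneq eA => <-.
  by move=> /(_ ae); rewrite (big_rem a) //= in l_big; lia.
have [w [c ew]] := @inv_mod_exp l k m%:Z pl lm.
(* By the choice of [w], this is [t] modulo [m] and [- e] modulo [l ^ k]. *)
pose t' := t + (m%:Z * w)%:~R * (- e - t).
have et' : e + t' = (l%:Z ^+ k)%:~R * (c%:~R * (- e - t)).
  by rewrite /t' ew mulrA -intrM intrD mulrDl mul1r; ring.
have lk0 : (0 < l ^ k)%N by rewrite expn_gt0 prime_gt0.
have [|l' pl' l'N|l' pl'|l' P a pl' l'm l'P aA|e' e'E|y [yA yE]] :=
   IHE (m * l ^ k)%N t'.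
- by rewrite muln_gt0 m0.
- by rewrite dvdn_mulr // mN.
- rewrite Euclid_dvdM // => /orP[/(mk _ pl')|]; first exact: dvdn_mulr.
  by rewrite Euclid_dvdX // dvdn_prime2 // => /andP[/eqP -> _]; exact: dvdn_mull.
- have [l'm'|nl'm'] := boolP (l' %| m)%N.
    have -> : a + t' = (a + t) + m%:Z%:~R * (w%:~R * (- e - t)).
      by rewrite /t' intrM; ring.
    move/(lies_over_mod l'P (m := m)); rewrite dvdzE abszX => /(_ (mk _ pl' l'm')).
    exact: hA l'P aA.
  have el : l' = l.
    move: l'm; rewrite Euclid_dvdM // (negbTE nl'm') /= Euclid_dvdX // dvdn_prime2 //.
    by case/andP => /eqP.
  rewrite {l'}el in pl' l'm nl'm' l'P *.
  have -> : a + t' = (a - e) + (l%:Z ^+ k)%:~R * (c%:~R * (- e - t)).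
    by rewrite -et'; ring.
  move/(lies_over_mod l'P (dvdzz _)) => h; have iP : ideal P by have /prime_idealP[] := l'P.1.
  move/negP: (lA _ aA); apply; apply: (lies_over_nm Q pl l'P).
  by case: (k) k2 h => // k' _; exact: ideal_mul_subl.
- by apply: hE; rewrite inE e'E orbT.
exists (w%:~R * (- e - t) + (l ^ k)%N%:~R * y).
have -> : t + m%:~R * (w%:~R * (- e - t) + (l ^ k)%N%:~R * y) =
    t' + (m * l ^ k)%N%:~R * y by rewrite /t' PoszM !intrM; ring.
split=> // e'; rewrite inE => /orP[/eqP ->|/yE //].
have [P lP] := lies_over_exists Q pl.
case/(kfreeP Q); first by lia.
move=> _ /(_ P lP.1); apply.
rewrite addrA et'.
have -> : (m * l ^ k)%N%:~R * y = (l%:Z ^+ k)%:~R * (m%:~R * y).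
  by rewrite PoszM intrM PoszX; ring.
by rewrite -mulrDr; exact: (ipow_int _ lP).
Qed.

Definition sieve_bound n : nat := (8 * n * cform * cform).+1.

Lemma kfree_translate_exists (A E : seq R) (t : R) :
  (forall l P a, prime l -> (l <= sieve_bound (size A))%N -> lies_over l P ->
     a \in A -> ~ ipow P k (a + t)) ->
  (forall e, e \in E -> e \notin A) ->
  exists u, (forall a, a \in A -> kfree k (a + u)) /\
    forall e, e \in E -> ~ kfree k (e + u).
Proof.
move=> hA hE; set N := sieve_bound _ in hA.
have dvdN l : prime l -> (l %| N`! ^ k)%N -> (l <= N)%N.
  by move=> pl; rewrite Euclid_dvdX // => /andP[/(prime_dvd_fact pl)].
have [|l pl lN|l pl|l P a pl /(dvdN l pl)|//|y hy] :=
   @sieve_sep A E N (N`! ^ k)%N t (ltn0Sn _) (leqnSn _).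
- by rewrite expn_gt0 fact_gt0.
- rewrite Euclid_dvdX //; apply/andP; split; last by lia.
  by apply: dvdn_fact; rewrite prime_gt0.
- rewrite Euclid_dvdX // => /andP[lf _]; exact: dvdn_exp2r.
- by move=> lN lP aA; exact: hA lN lP aA.
- by exists (t + (N`! ^ k)%N%:~R * y).
Qed.

End Sieve.

(** * The k-free shift *)

Section Cylinders.
Implicit Types (x y v : config) (F : seq (int * int)).

Definition agree F x y := forall n, n \in F -> y n = x n.

Lemma nbhs_coord x n : nbhs x [set y : config | y n = x n].
Proof. have xn : nbhs (x n) [set b | b = x n] by apply/principal_filterP.
exact: (@proj_continuous _ (fun _ : int * int => bool) n x _ xn). Qed.

Lemma nbhs_cylinder x F : nbhs x [set y | agree F x y].
Proof.
elim: F => [|n F IHF]; first by apply: filterS filterT => y _ n.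
apply: filterS (filterI (nbhs_coord x n) IHF) => y /= [yn yF] m.
by rewrite inE => /orP[/eqP ->|/yF].
Qed.

Lemma nbhs_configP x (B : set config) : nbhs x B <-> exists F, agree F x `<=` B.
Proof.
split; last by case=> F FB; apply: (filterS FB); exact: nbhs_cylinder.
pose G : set_system config := [set B | exists F, agree F x `<=` B].
have FG : Filter G.
  split; first by exists [::].
    move=> A C [F FA] [F' FC]; exists (F ++ F') => y yF; split.
      by apply: FA => n nF; apply: yF; rewrite mem_cat nF.
    by apply: FC => n nF; apply: yF; rewrite mem_cat nF orbT.
  by move=> A C sAC [F FA]; exists F; exact: subset_trans sAC.
suff : G --> x by apply.
apply/cvg_sup => n A [_ [[C oC <-] Cx] CA]; exists [:: n] => y yF.
by apply: CA; rewrite /= /proj yF // mem_head.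
Qed.

Lemma orbit_closureP v x :
  orbit_closure v x <-> forall F, exists t, forall n, n \in F -> x n = v (n - t).
Proof.
split=> [vx F|h B /nbhs_configP[F FB]].
  have [_ [[t _ <-] /= xt]] := vx _ (nbhs_cylinder x F).
  by exists t => n nF; rewrite -xt.
have [t xt] := h F; exists (tshift t v); split; first by exists t.
by apply: FB => n nF; rewrite xt.
Qed.

(** Continuity at one point read on cylinders. The window [F] depends on [x] as well as on [n]. *)
Lemma orbit_closure_continuous v (H : orbit_closure v -> orbit_closure v)
    (x : orbit_closure v) (n : int * int) : continuous H ->
  exists F, forall y : orbit_closure v, agree F (val x) (val y) ->
    val (H y) n = val (H x) n.
Proof.
move=> cH.
have : nbhs x [set y : orbit_closure v | val (H y) n = val (H x) n].
  apply: (cH x [set z : orbit_closure v | val z n = val (H x) n]).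
  exact: (@initial_continuous _ _ (@set_val _ (orbit_closure v)) (H x) _
    (nbhs_coord (val (H x)) n)).
move=> [_ [[B oB <-] Bx] sB].
have /nbhs_configP[F FB] : nbhs (val x) B by apply: open_nbhs_nbhs.
by exists F => y yF; apply: sB; exact: FB.
Qed.

Lemma orbit_closure_map_continuous v (A : int * int -> int * int)
    (H : orbit_closure v -> orbit_closure v) :
  (forall (x : orbit_closure v) n, val (H x) n = val x (A n)) -> continuous H.
Proof.
move=> HA x B [_ [[C oC <-] Cx] CB].
have /nbhs_configP[F FC] : nbhs (val (H x)) C by apply: open_nbhs_nbhs.
have : nbhs x [set y : orbit_closure v | agree (map A F) (val x) (val y)].
  exact: (@initial_continuous _ _ (@set_val _ (orbit_closure v)) x _
    (nbhs_cylinder (val x) (map A F))).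
apply: filterS => y yF; apply: CB; apply: FC => n nF.
apply: (etrans (HA y n)); rewrite HA.
exact: (yF _ (map_f A nF)).
Qed.

End Cylinders.

(** * Finite configurations and the residue classes they miss *)

Section Shift.
Variables (R : comNzRingType) (Q : quad_ring R) (k : nat).
Hypothesis k2 : (2 <= k)%N.
Local Notation cj := (cj Q).
Local Notation co := (co Q).
Local Notation pt := (pt Q).
Local Notation nm := (nm Q).
Local Notation phi := (phi Q).
Implicit Types (z t : R) (P : set R) (F : seq (int * int)).

Definition kfree_config : config := char_fun [set m | kfree k (pt m)].
Local Notation X := (orbit_closure kfree_config).

Definition points_config (A : seq R) : config := fun n => pt n \in A.

Lemma in_shiftP (x : config) :
  X x <-> forall F, exists u, forall n, n \in F -> x n = `[< kfree k (pt n + u) >].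
Proof.
rewrite orbit_closureP; split=> h F; have [t xt] := h F.
  by exists (- pt t) => n /xt ->; rewrite /kfree_config /char_fun /= ptD ptN.
exists (- co t) => n /xt ->; rewrite /kfree_config /char_fun /=.
by rewrite opprK ptD coKpt.
Qed.

(** The points of the window outside [A] are passed to the sieve as points to be made non-k-free;
    its bound depends only on the size of [A], so one hypothesis serves all windows. *)
Lemma points_in_shift (A : seq R) t :
  (forall l P a, prime l -> (l <= sieve_bound Q (size A))%N -> lies_over l P ->
     a \in A -> ~ ipow P k (a + t)) -> X (points_config A).
Proof.
move=> hA; apply/in_shiftP => F.
have [e|u [uA uE]] := kfree_translate_exists k2 (E := [seq pt n | n <- F & pt n \notin A]) hA.
  by case/mapP => n; rewrite mem_filter => /andP[? _] ->.
exists u => n nF; rewrite /points_config; have [nA|nA] := boolP (pt n \in A).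
  by apply/esym/asboolP; exact: uA.
by apply/esym/asboolPn; apply: uE; apply: map_f; rewrite mem_filter nA.
Qed.

Lemma kfree_ipow x l P : lies_over l P -> kfree k x -> ~ ipow P k x.
Proof. by move=> lP /(kfreeP Q)[|_]; [lia|apply; case: lP]. Qed.

Lemma kfree1 : kfree k (1 : R).
Proof.
apply/(kfreeP Q); first lia; split=> [|P pP]; first exact: oner_neq0.
have /prime_idealP[iP P1 _] := pP; move: (k) k2 => [//|k' _ h].
by apply: P1; exact: (ideal_mul_subl iP h).
Qed.

(** One witness per class gives a finite window, on which [x] is a translate by some [u] of the
    k-free pattern. The witness in the class of [- phi e u] is sent to a multiple of [l ^ k]. *)
Lemma shift_misses_residue l e (x : X) : split_prime Q l k e ->
  ~ (forall a : int, exists n, val x n /\ (l%:Z ^+ k %| phi e (pt n) - a)%Z).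
Proof.
move=> spl full; have [pl _ _ _] := spl.
have /choice[g hg] : forall a : 'I_(l ^ k), exists n, val x n /\ (l%:Z ^+ k %| phi e (pt n) - a%:Z)%Z.
  by move=> a; exact: full.
have [u hu] := (in_shiftP (val x)).1 (set_mem (valP x)) (map g (enum 'I_(l ^ k))).
have q0 : l%:Z ^+ k != 0 by rewrite expf_neq0 //; case: l pl {spl full g hg hu}.
pose b := (- phi e u %% l%:Z ^+ k)%Z.
have b0 : 0 <= b by exact: modz_ge0.
have bl : (`|b| < l ^ k)%N.
  have : b < l%:Z ^+ k by apply: ltz_pmod; lia.
  by rewrite -PoszX; lia.
have [xa qa] := hg (Ordinal bl).
have := hu (g (Ordinal bl)); rewrite map_f ?mem_enum // xa => /(_ isT)/esym/asboolP.
apply: (split_not_kfree spl); rewrite phiD.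
have -> : phi e (pt (g (Ordinal bl))) + phi e u =
  (phi e (pt (g (Ordinal bl))) - (Ordinal bl)%:Z) + (b - - phi e u).
  by rewrite /= gez0_abs //; ring.
rewrite rpredD //.
by apply/dvdz_mod0P; rewrite /b modzDml subrr mod0z.
Qed.

Lemma avoid_exists (E : seq R) (b : R) (w : int) : w != 0 ->
  exists r, b + w%:~R * r \notin E.
Proof.
move=> w0; apply: contrapT => h.
pose s := [seq b + w%:~R * (Posz j)%:~R | j <- iota 0 (size E).+1].
have us : uniq s.
  rewrite map_inj_uniq ?iota_uniq // => i j /addrI/(intr_mulI Q w0).
  by move=> /(@intr_injR _ Q)[].
have : (size s <= size E)%N.
  apply: uniq_leq_size us _ => _ /mapP[j _ ->].
  by apply: contraT => nE; case: h; exists (Posz j)%:~R.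
by rewrite size_map size_iota ltnn.
Qed.

(** Greedy choice: each new point has infinitely many candidates in its class and finitely many
    forbidden values. Differences are excluded in both orders. *)
Lemma spread_exists n (b : nat -> R) (w : int) (E : seq R) : w != 0 ->
  exists g : nat -> R, forall i, (i < n)%N ->
    [/\ exists r, g i = b i + w%:~R * r, g i \notin E &
      forall j, (j < n)%N -> j != i -> g j - g i \notin E].
Proof.
move=> w0; elim: n => [|n [g hg]]; first by exists b.
have [r] := avoid_exists (E ++ [seq g j + x | j <- iota 0 n, x <- E] ++
  [seq g j - x | j <- iota 0 n, x <- E]) (b n) w0.
set z := b n + _; rewrite !mem_cat !negb_or => /and3P[zE zD zB].
have gz j : (j < n)%N -> g j - z \notin E.
  move=> jn; apply: contra zB => h; apply/allpairsP; exists (j, g j - z).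
  by rewrite mem_iota add0n jn /=; split=> //; ring.
have zg j : (j < n)%N -> z - g j \notin E.
  move=> jn; apply: contra zD => h; apply/allpairsP; exists (j, z - g j).
  by rewrite mem_iota add0n jn /=; split=> //; ring.
exists (fun i => if i == n then z else g i) => i; rewrite ltnS leq_eqVlt.
case: eqVneq => [-> _|ne /= lin].
  split=> [||j]; [by exists r|exact: zE|].
  by rewrite ltnS leq_eqVlt; case: eqVneq => //= _ jn _; exact: gz.
have [h1 h2 h3] := hg i lin; split=> // j; rewrite ltnS leq_eqVlt.
by case: eqVneq => [_ _ _|_ /= jn]; [exact: zg|exact: h3].
Qed.

(* The points [g i] lie in a single class modulo all small primes other than
   [l], while the classes modulo [l ^ k] are prescribed by [f]. *)
Lemma extension l e (A : seq R) t n (f : nat -> R) (c : R) (E : seq R) :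
  split_prime Q l k e -> (forall a, a \in A -> kfree k (a + t)) ->
  (forall z, z \in A \/ (exists2 i, (i < n)%N & z = f i) ->
    ~~ (l%:Z ^+ k %| phi e (z + c))%Z /\ ~~ (l%:Z ^+ k %| phi e (cj (z + c)))%Z) ->
  exists g : nat -> R,
    [/\ forall i, (i < n)%N -> exists r, g i = f i + (l%:Z ^+ k)%:~R * r,
       forall i, (i < n)%N -> g i \notin E,
       forall i j, (i < n)%N -> (j < n)%N -> j != i -> g j - g i \notin E &
       X (points_config (A ++ mkseq g n))].
Proof.
move=> spl At hc; have [pl k0 _ _] := spl.
pose N := sieve_bound Q (size A + n).
(* All primes up to [N] other than [l], whose classes are governed separately by [f]. *)
pose m0 := (\prod_(p <- iota 0 N.+1 | prime p && (p != l)) p)%N.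
pose m := (m0 ^ k)%N.
have dm p : prime p -> (p <= N)%N -> p != l -> (p ^ k %| m)%N.
  move=> pp pN pl'; rewrite /m dvdn_exp2r // /m0 (big_rem p); last by rewrite mem_iota.
  by rewrite pp pl'; exact: dvdn_mulr.
have lm : ~~ (l %| m%:Z)%Z.
  rewrite dvdzE /= /m Euclid_dvdX // k0 andbT /m0.
  apply: (big_ind (fun x => ~~ (l %| x)%N)).
  - by rewrite dvdn1; case: (l) pl => [|[]].
  - by move=> x y lx ly; rewrite Euclid_dvdM // negb_or lx.
  - by move=> p /andP[pp pl']; rewrite dvdn_prime2 // eq_sym.
have mgt0 : (0 < m)%N by rewrite lt0n; apply: contraNneq lm => ->; rewrite dvdz0.
set q := l%:Z ^+ k in hc *.
have q0 : q != 0 by rewrite expf_neq0 //; case: (l) pl.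
have [w [d ew]] := inv_mod_exp k pl lm; rewrite -/q in ew.
pose u := m%:Z * w.
(* As [u] is 0 modulo [m] and 1 modulo [q], this is [f i] modulo [q], and modulo [m] it becomes 1, a
   k-free element, after translation by [t]. *)
pose b i := 1 - t + u%:~R * (f i - (1 - t)).
have mq0 : m%:Z * q != 0 by rewrite mulf_neq0 //; lia.
have [g hg] := spread_exists n b E mq0.
have gq i : (i < n)%N -> exists r, g i = f i + q%:~R * r.
  case/hg => [[r ->] _ _]; exists (d%:~R * (f i - (1 - t)) + m%:~R * r).
  by rewrite /b /u ew !intrM intrD intrM; ring.
have gm i : (i < n)%N -> exists r, g i = 1 - t + m%:~R * r.
  case/hg => [[r ->] _ _]; exists (w%:~R * (f i - (1 - t)) + q%:~R * r).
  by rewrite /b /u !intrM; ring.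
exists g; split=> //; [by move=> i /hg[]|by move=> i j /hg[_ _ h] /h|].
(* The same interpolation for the translation vector: [t] modulo [m], [c] modulo [q]. *)
pose t' := t + u%:~R * (c - t).
have et'm : t' = t + m%:~R * (w%:~R * (c - t)) by rewrite /t' /u intrM; ring.
have et'q : t' = c + q%:~R * (d%:~R * (c - t)).
  by rewrite /t' /u ew intrD intrM; ring.
apply: (@points_in_shift _ t') => p P a pp; rewrite size_cat size_mkseq -/N => pN pP aA.
have zg : a \in A \/ exists2 i, (i < n)%N & a = g i.
  move: aA; rewrite mem_cat => /orP[|/mapP[i]]; first by left.
  by rewrite mem_iota => /andP[_ lin] ->; right; exists i.
have [epl|npl] := eqVneq p l.
  rewrite {p}epl in pp pN pP *.
  have [z [hz [r ->]]] : exists z, (z \in A \/ (exists2 i, (i < n)%N & z = f i)) /\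
      exists r, a = z + q%:~R * r.
    case: zg => [aA'|[i lin ->]].
      by exists a; split; [left|exists 0; rewrite mulr0 addr0].
    by exists (f i); split; [right; exists i|exact: gq].
  rewrite et'q.
  have -> : z + q%:~R * r + (c + q%:~R * (d%:~R * (c - t))) =
     z + c + q%:~R * (r + d%:~R * (c - t)) by ring.
  have [h1 h2] := hc z hz.
  by move/(lies_over_mod pP (dvdzz _))/(split_ipow_phi spl pP) => []; exact/negP.
have pm : (p%:Z ^+ k %| m%:Z)%Z by rewrite -PoszX dvdzE; exact: dm.
rewrite et'm; case: zg => [aA'|[i lin ->]].
  by rewrite addrA => /(lies_over_mod pP pm); apply: kfree_ipow pP _; exact: At.
have [r ->] := gm i lin.
have -> : 1 - t + m%:~R * r + (t + m%:~R * (w%:~R * (c - t))) =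
   1 + m%:~R * (r + w%:~R * (c - t)) by ring.
by move/(lies_over_mod pP pm); apply: kfree_ipow pP _; exact: kfree1.
Qed.

End Shift.

(** * Equivariant homeomorphisms *)

Lemma dvdz_exp_cancel (l k : nat) (n x : int) : prime l -> ~~ (l %| n)%Z ->
  (l%:Z ^+ k %| n * x)%Z -> (l%:Z ^+ k %| x)%Z.
Proof.
move=> pl ln h; have [w [c e]] := inv_mod_exp k pl ln.
have -> : x = n * x * w - l%:Z ^+ k * (c * x).
  by transitivity (n * w * x - l%:Z ^+ k * (c * x)); [rewrite e|]; ring.
by apply: rpredB; [exact: dvdz_mulr|exact: (dvdz_mulr _ (dvdzz _))].
Qed.

Lemma ndvdz_small (q : nat) (u : int) : 0 < u -> u < q%:Z -> ~~ (q %| u)%Z.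
Proof. by move=> u0 uq; apply/negP; rewrite dvdzE => /dvdn_leq /=; lia. Qed.

Lemma absz_modz_lt (q : nat) (a : int) : (0 < q)%N -> (`|(a %% q)%Z| < q)%N.
Proof.
move=> q0; have := modz_ge0 a (_ : q%:Z != 0); have := ltz_pmod a (_ : 0 < q%:Z).
by rewrite ltz_nat q0 => /(_ isT) h1 /(_ _) h2; have := h2; lia.
Qed.

Section Equivariant.
Variables (R : comNzRingType) (Q : quad_ring R) (k : nat).
Hypothesis k2 : (2 <= k)%N.
Local Notation cj := (cj Q).
Local Notation dl := (dl Q).
Local Notation co := (co Q).
Local Notation pt := (pt Q).
Local Notation nm := (nm Q).
Local Notation phi := (phi Q).
Local Notation X := (orbit_closure (kfree_config Q k)).
Local Notation points_config := (points_config Q).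
Local Notation translate := (@translate (kfree_config Q k)).

Definition point_of_shift (A : seq R) (h : X (points_config A)) : X := exist _ (points_config A) (mem_set h).

Lemma empty_in_shift : X (points_config [::]).
Proof. exact: (@points_in_shift _ _ _ k2 [::] 0). Qed.

Lemma origin_in_shift : X (points_config [:: 0]).
Proof.
apply: (@points_in_shift _ _ _ k2 _ 1) => l P a _ _ lP.
rewrite inE => /eqP ->; rewrite add0r; apply: (kfree_ipow Q k2 lP).
exact: (kfree1 Q k2).
Qed.

Lemma in_shift_kfree (x : X) (F : seq (int * int)) :
  exists u, forall n, n \in F -> val x n -> kfree k (pt n + u).
Proof.
have [u hu] := (in_shiftP Q k (val x)).1 (set_mem (valP x)) F.
by exists u => n nF; rewrite hu // => /asboolP.
Qed.

(** Heredity: a translation making the points of [x] over [A] k-free also avoids all local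
    obstructions for [A]. *)
Lemma subset_in_shift (x : X) (A : seq R) :
  (forall a, a \in A -> val x (co a)) -> X (points_config A).
Proof.
move=> hA; have [u hu] := in_shift_kfree x (map co A).
apply: (@points_in_shift _ _ _ k2 _ u) => l P a _ _ lP aA.
apply: (kfree_ipow Q k2 lP); rewrite -(coKpt Q a); apply: hu; first exact: map_f.
exact: hA.
Qed.

Definition origin : X := point_of_shift origin_in_shift.

Lemma originE n : val origin n = (n == 0).
Proof.
rewrite /= /points_config inE -(pt0 Q); apply/eqP/eqP => [|-> //].
exact: (can_inj (@ptK _ Q)).
Qed.

Variables (H : X -> X) (M : {additive int * int -> int * int}).
Hypothesis cH : continuous H.
Hypothesis HM : forall t x, H (translate t x) = translate (M t) (H x).
Hypothesis H0 : val (H origin) 0.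

(** Continuity at [origin], whose image contains 0, transported by translation: a point isolated
    within the window [F] survives as its image under [M]. *)
Lemma equivariant_local : exists F : seq (int * int), forall (x : X) a,
  (forall n, n \in F -> val x (n + a) = (n == 0)) -> val (H x) (M a).
Proof.
have [F hF] := orbit_closure_continuous origin 0 cH; exists F => x a hx.
have <- : val (H (translate (- a) x)) 0 = val (H x) (M a).
  by rewrite HM /= /tshift raddfN opprK add0r.
rewrite hF // => n nF; rewrite originE /= /tshift opprK; exact: hx.
Qed.

Lemma equivariant_extension l e (A : seq R) t n (f : nat -> R) (c : R) (xA : X) y :
  val xA = points_config A -> split_prime Q l k e -> (forall a, a \in A -> kfree k (a + t)) ->
  (forall z : R, z \in A \/ (exists2 i, (i < n)%N & z = f i) ->
    ~~ (l%:Z ^+ k %| phi e (z + c))%Z /\ ~~ (l%:Z ^+ k %| phi e (cj (z + c)))%Z) ->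
  exists (g : nat -> R) (x : X),
    [/\ forall i, (i < n)%N -> exists r, g i = f i + (l%:Z ^+ k)%:~R * r,
       forall i, (i < n)%N -> val (H x) (M (co (g i))) &
       val (H x) y = val (H xA) y].
Proof.
move=> exA spl At hc; have [F hF] := equivariant_local.
have [F' hF'] := orbit_closure_continuous xA y cH.
(* The forbidden lists isolate the new points from one another, keep them off the window [F'] that
   determines the image of [xA] at [y], and isolate them from [A]. *)
have [g [gf gE gD gX]] := extension k2
  ([seq pt m | m <- F] ++ [seq pt m | m <- F'] ++ [seq a - pt m | a <- A, m <- F]) spl At hc.
exists g, (point_of_shift gX); split=> //.
  move=> i lin; apply: hF => m mF; rewrite /= /points_config ptD coKpt mem_cat.
  have nA : pt m + g i \notin A.
    apply/negP => hA; case/negP: (gE _ lin); rewrite !mem_cat; apply/orP; right.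
    apply/orP; right; apply/allpairsP; exists (pt m + g i, m); split=> //=; ring.
  rewrite (negbTE nA) /=; apply/mapP/eqP => [[j]|->]; last first.
    by exists i; rewrite ?mem_iota // pt0 add0r.
  rewrite mem_iota add0n => /andP[_ ljn] e1.
  have [ji|ji] := eqVneq j i.
    by apply: (can_inj (@ptK _ Q)); rewrite pt0; apply: (addIr (g i)); rewrite add0r e1 ji.
  case/negP: (gD i j lin ljn ji); rewrite -e1 addrK.
  by rewrite !mem_cat map_f.
apply: hF' => m mF'; rewrite exA /= /points_config mem_cat.
case: (boolP (pt m \in A)) => //= _; apply/negbTE/negP => /mapP[i].
rewrite mem_iota add0n => /andP[_ lin] e1; case/negP: (gE _ lin).
by rewrite -e1 !mem_cat (map_f _ mF') orbT.
Qed.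

Definition ring_map (x : R) : R := pt (M (co x)).

Lemma ring_mapD x y : ring_map (x + y) = ring_map x + ring_map y.
Proof. by rewrite /ring_map coD raddfD ptD. Qed.

Lemma ring_mapN x : ring_map (- x) = - ring_map x.
Proof. by rewrite /ring_map coN raddfN ptN. Qed.

Lemma ring_map0 : ring_map 0 = 0.
Proof. by apply: (addrI (ring_map 0)); rewrite -ring_mapD !addr0. Qed.

Lemma ring_mapZ (n : int) x : ring_map (n%:~R * x) = n%:~R * ring_map x.
Proof.
have MrZn (m : nat) : ring_map (m%:~R * x) = m%:~R * ring_map x.
  elim: m => [|m IHm]; first by rewrite !mul0r ring_map0.
  by rewrite intS !intrD !mulrDl !mul1r ring_mapD IHm.
case: n => m; first exact: MrZn.
by rewrite NegzE !intrN !mulNr ring_mapN MrZn.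
Qed.

Lemma ring_map_basis x : ring_map x = (co x).1%:~R * ring_map 1 + (co x).2%:~R * ring_map dl.
Proof.
by rewrite -{1}(coK Q x) ring_mapD -[X in ring_map X + _]mulr1 !ring_mapZ.
Qed.

(* Over the fraction field, [ring_map x = (al * x + be * cj x) / (dl - cj dl)]. *)
Lemma equivariant_form : (forall x, ring_map x = cj x * ring_map 1) \/ (forall x, ring_map x = x * ring_map 1).
Proof.
pose al := ring_map dl - cj dl * ring_map 1; pose be := dl * ring_map 1 - ring_map dl.
have DM x : (dl - cj dl) * ring_map x = al * x + be * cj x.
  rewrite ring_map_basis -{3 4}(coK Q x) rmorphD rmorphM !rmorph_int /al /be; ring.
have cjb x : cj x = (co x).1%:~R + (co x).2%:~R * cj dl.
  by rewrite -{1}(coK Q x) rmorphD rmorphM !rmorph_int.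
suff [/eqP e|/eqP e] : al = 0 \/ be = 0.
- left=> x; rewrite ring_map_basis; move: e; rewrite subr_eq0 => /eqP ->.
  by rewrite (cjb x); ring.
- right=> x; rewrite ring_map_basis; move: e; rewrite subr_eq0 => /eqP <-.
  by rewrite -[X in _ = X * _](coK Q x); ring.
(* A prime exceeding both norms makes [al] and [be] units modulo the prime of [phi e]; the summand 2
   keeps the residues 1 and 2 non-zero. *)
apply: contrapT => /not_orP[/eqP al0 /eqP be0].
have [l [e [lbig spl]]] := split_prime_exists Q (`|nm al| + `|nm be| + 2)%N (ltnW k2).
have l2 : (2 < l)%N by lia.
have lal0 : (`|nm al| < l)%N by lia.
have lbe0 : (`|nm be| < l)%N by lia.
have [pl k0 le ln] := spl; set q := l%:Z ^+ k in le *.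
have lq : (l %| q)%Z by rewrite /q; case: (k) k0 => // k' _; rewrite exprS dvdz_mulr.
have nl z : z != 0 -> (`|nm z| < l)%N -> ~~ (l %| phi e z)%Z.
  move=> z0 zl; apply/negP => /(phi_dvd_nm (split_dvd_qform spl)).
  by rewrite dvdzE => /dvdn_leq; rewrite absz_gt0 nm_eq0 z0 => /(_ isT) /=; rewrite leqNgt zl.
have lal : ~~ (l %| phi e al)%Z by apply: nl.
have lbe : ~~ (l %| phi e be)%Z by apply: nl.
have phiDl : phi e (dl - cj dl) = 2 * e - tau Q.
  by rewrite phiB /phi co_cj co_dl /=; ring.
have small (u : int) : 0 < u <= 2 -> ~~ (q %| u)%Z.
  move=> /andP[u0 u2]; apply/negP => /(dvdz_trans lq); apply/negP.
  by apply: ndvdz_small => //; apply: le_lt_trans u2 _; rewrite ltz_nat.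
have /choice[f hf] : forall i : nat, exists x,
    [/\ (q %| phi e (ring_map x) - i%:Z)%Z, ~~ (q %| phi e x)%Z & ~~ (q %| phi e (cj x))%Z].
  move=> i; set T := (2 * e - tau Q) * i%:Z.
  (* [u] is the residue of [x], and the residue of [cj x] is then forced to be [(T - al * u) / be].
     The values of [T - al * u] at 1 and 2 differ by a unit, so at least one is non-zero modulo
     [q]. *)
  have [u [u2 Tu]] : exists u, 0 < u <= 2 /\ ~~ (q %| T - phi e al * u)%Z.
    have [h1|] := boolP (q %| T - phi e al * 1)%Z; last by exists 1.
    exists 2; split=> //; apply: contra lal => h2; apply: (dvdz_trans lq).
    have -> : phi e al = (T - phi e al * 1) - (T - phi e al * 2) by ring.
    by rewrite rpredB.
  have [w [c ew]] := inv_mod_exp k pl lbe; rewrite -/q in ew.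
  pose v := w * (T - phi e al * u).
  have ev : phi e be * v = (T - phi e al * u) + q * (c * (T - phi e al * u)).
    by rewrite /v mulrA ew; ring.
  have nv : ~~ (q %| v)%Z.
    apply: contra Tu => h; have := dvdz_mull (phi e be) h.
    by rewrite ev rpredDr // (dvdz_mulr _ (dvdzz _)).
  have [x [xu xv]] := phi_onto u v spl; rewrite -/q in xv.
  exists x; split; last 2 first.
  - by rewrite xu; exact: small.
  - by apply: contra nv => h; rewrite -(subKr (phi e (cj x)) v) rpredB.
  apply: (dvdz_exp_cancel pl ln).
  have := congr1 (phi e) (DM x); rewrite phiD !phiM phiDl xu => e1.
  have -> : (2 * e - tau Q) * (phi e (ring_map x) - i%:Z) =
    (phi e al * u + phi e be * v - T) + phi e be * (phi e (cj x) - v) +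
    qform Q e * ((co (dl - cj dl)).2 * (co (ring_map x)).2 -
       (co al).2 * (co x).2 - (co be).2 * (co (cj x)).2).
    rewrite mulrBr -/T.
    by rewrite (canRL (subrK _) e1); ring.
  rewrite ev; apply: rpredD; last exact: dvdz_mulr.
  apply: rpredD; last exact: dvdz_mull.
  by apply/dvdzP; exists (c * (T - phi e al * u)); ring.
(* With [A] empty and [c = 0], the [l ^ k] points avoid the zero class at both primes, yet their
   images fill every class. *)
have [z|g [x [gf gH _]]] := @equivariant_extension l e [::] 0 (l ^ k) f 0 (point_of_shift empty_in_shift) 0
   erefl spl (fun _ h => False_ind _ (notF h)).
  by case=> // -[i _ ->]; rewrite addr0; have [] := hf i.
apply: (shift_misses_residue k2 (x := H x) spl) => a.
have q0 : q != 0 by rewrite expf_neq0 //; case: (l) pl.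
have a0 : 0 <= (a %% q)%Z by exact: modz_ge0.
have al' : (`|(a %% q)%Z| < l ^ k)%N.
  by rewrite /q -PoszX; apply: absz_modz_lt; rewrite expn_gt0 prime_gt0.
exists (M (co (g `|(a %% q)%Z|%N))); split; first exact: gH.
have [r er] := gf _ al'; have [h _ _] := hf `|(a %% q)%Z|%N.
rewrite -/(ring_map _) er ring_mapD ring_mapZ phiD phiZ -/q.
rewrite gez0_abs // in h.
have -> : phi e (ring_map (f `|(a %% q)%Z|%N)) + q * phi e (ring_map r) - a =
  (phi e (ring_map (f `|(a %% q)%Z|%N)) - (a %% q)%Z) + q * (phi e (ring_map r) - (a %/ q)%Z).
  by rewrite [X in _ - X = _](divz_eq a q); ring.
by rewrite rpredD // (dvdz_mulr _ (dvdzz _)).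
Qed.

(** Suppose [y] is a point of [H xA] outside [A]. Isolated points are added to [A] in all classes
    modulo [P ^ k] except that of [y]. They persist in the image and so does [y], so the image meets
    every class. *)
Lemma commuting_sub (A : seq R) (xA : X) y : (forall n, M n = n) ->
  val xA = points_config A -> val (H xA) y -> pt y \in A.
Proof.
move=> M1 exA Hy; apply: contraT => yA; set y' := pt y in yA.
have [t ht] := in_shift_kfree xA (map co A).
have At a : a \in A -> kfree k (a + t).
  move=> aA; rewrite -(coKpt Q a); apply: ht; first exact: map_f.
  by rewrite exA /points_config coKpt.
have [l [e [lbig spl]]] := split_prime_exists Q (\sum_(a <- A) `|nm (a - y')| + 1)%N (ltnW k2).
have [pl k0 le ln] := spl; set q := l%:Z ^+ k in le *.
have lq : (l %| q)%Z by rewrite /q; case: (k) k0 => // k' _; rewrite exprS dvdz_mulr.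
have q0 : q != 0 by rewrite expf_neq0 //; case: (l) pl.
have eq : q = Posz (l ^ k) by rewrite PoszX.
have q1 : (1 < l ^ k)%N by apply: (@leq_trans l); [exact: prime_gt1|rewrite -{1}(expn1 l) leq_exp2l ?prime_gt1].
have lk0 : (0 < l ^ k)%N by exact: ltnW.

have nA a : a \in A -> ~~ (l %| nm (a - y'))%Z.
  move=> aA; apply/negP; rewrite dvdzE => /dvdn_leq; rewrite absz_gt0 nm_eq0 subr_eq0.
  have ay : a != y' by apply: contraNneq yA => <-.
  move=> /(_ ay); rewrite (big_rem a) //= in lbig.
  by clear -lbig; lia.
(* [f i] has residue [i + 1] at one prime and 1 at the conjugate. For [i < l ^ k - 1] neither
   residue of [f i] is zero, so [y' + f i] avoids the class of [y'] at both primes; [A] avoids it by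
   the choice of [l]. *)
have /choice[f hf] : forall i : nat, exists x,
    phi e x = i.+1%:Z /\ (q %| phi e (cj x) - 1)%Z.
  by move=> i; exact: phi_onto.
have nq (u : int) : 0 < u -> u < q -> ~~ (q %| u)%Z by rewrite eq; exact: ndvdz_small.
have [z|g [x [gf gH gy]]] := @equivariant_extension l e A t (l ^ k).-1 (fun i => y' + f i) (- y')
    xA y exA spl At.
  case=> [zA|[i lin ->]].
    split; apply: contra (nA _ zA) => h; apply: (dvdz_trans lq).
      exact: (phi_dvd_nm le h).
    by rewrite -(nm_cj Q); exact: (phi_dvd_nm le h).
  have [h1 h2] := hf i; rewrite addrAC subrr add0r h1; split.
    by apply: nq; rewrite // eq ltz_nat; move: (l ^ k)%N lin; clear; lia.
  apply: (contra _ (nq 1 _ _)) => [h||] //; last by rewrite eq ltz_nat.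
  by rewrite -(subKr (phi e (cj (f i))) 1) rpredB.
exfalso; apply: (shift_misses_residue k2 (x := H x) spl) => a.
pose b := ((a - phi e y') %% q)%Z.
have b0 : 0 <= b by exact: modz_ge0.
have bq : b < q by apply: ltz_pmod; rewrite eq ltz_nat.
have eb : b = a - phi e y' - ((a - phi e y') %/ q)%Z * q.
  by rewrite /b [X in _ = X - _](divz_eq (a - phi e y') q); ring.
(* The class of [y'] is met by [y] itself, and any other class by the added point of index
   [b - 1]. *)
have [bz|bnz] := eqVneq b 0.
  exists y; split; first by rewrite gy.
  rewrite -/q -/y'; move: eb; rewrite bz; set d := (_ %/ _)%Z => eb.
  have edq : d * q = a - phi e y' by apply/eqP; rewrite eq_sym -subr_eq0 -eb.
  by apply/dvdzP; exists (- d); rewrite mulNr edq opprB.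
have lin : (`|b|.-1 < (l ^ k).-1)%N.
  by move: bq b0 bnz; rewrite eq; generalize b (l ^ k)%N; clear; lia.
have [r er] := gf _ lin; have [h _] := hf `|b|.-1.
exists (co (g `|b|.-1)); split; first by rewrite -{1}(M1 (co _)); exact: gH.
rewrite coKpt er phiD phiD phiZ h -/q.
have -> : `|b|.-1.+1%:Z = b by move: b0 bnz; generalize b; clear; lia.
rewrite eb; set d := (_ %/ _)%Z.
by apply/dvdzP; exists (phi e r - d); ring.
Qed.

End Equivariant.

(** * Homeomorphisms commuting with translations *)

Section Centralising.
Variables (R : comNzRingType) (Q : quad_ring R) (k : nat).
Hypothesis k2 : (2 <= k)%N.
Local Notation co := (co Q).
Local Notation pt := (pt Q).
Local Notation X := (orbit_closure (kfree_config Q k)).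
Local Notation points_config := (points_config Q).
Local Notation translate := (@translate (kfree_config Q k)).

(** Neither [h] nor its inverse enlarges a finite configuration, so both fix each of them; density
    concludes. *)
Lemma commuting_id (h : homeo X) : (forall t x, h (translate t x) = translate t (h x)) ->
  val (h (origin Q k2)) 0 -> h =1 id.
Proof.
move=> hT h0.
have hT' t x : hinv h (translate t x) = translate t (hinv h x).
  by apply: (can_inj (@hfunK _ h)); rewrite hT !hinvK.
pose M : {additive int * int -> int * int} := idfun.
have sub A (xA : X) y : val xA = points_config A -> val (h xA) y -> pt y \in A.
  exact: (commuting_sub (@hfun_continuous _ h) (M := M) hT h0 (fun=> erefl)).
have h_origin : h (origin Q k2) = origin Q k2.
  apply: val_inj; apply/funext => n; rewrite originE; apply/idP/eqP => [|-> //].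
  move/(sub [:: 0] (origin Q k2) n erefl); rewrite inE => /eqP e.
  by apply: (can_inj (@ptK _ Q)); rewrite e pt0.
have h0' : val (hinv h (origin Q k2)) 0 by rewrite -{1}h_origin hfunK originE.
have sub' A (xA : X) y : val xA = points_config A -> val (hinv h xA) y -> pt y \in A.
  exact: (commuting_sub (@hinv_continuous _ h) (M := M) hT' h0' (fun=> erefl)).
have fin A (xA : X) : val xA = points_config A -> h xA = xA.
  move=> eA; apply: val_inj; rewrite eA.
  (* The image of a finite configuration is a part of it, hence finite, so the inclusion for the
     inverse applies to it. *)
  pose A' := [seq a <- A | val (h xA) (co a)].
  have e' : val (h xA) = points_config A'.
    apply/funext => n; rewrite /points_config mem_filter ptK.
    by case: (boolP (val (h xA) n)) => //= /(sub _ _ _ eA) ->.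
  apply/funext => n; apply/idP/idP; first exact: sub.
  move=> nA; have : val (hinv h (h xA)) n by rewrite hfunK eA.
  by move/(sub' _ _ _ e'); rewrite e'.
move=> x; apply: val_inj; apply/funext => n.
have [F hF] := orbit_closure_continuous x n (@hfun_continuous _ h).
(* The truncation of [x] to the window that determines [h x] at [n], with [n] added so that [x]
   itself can be read there. *)
pose A := [seq pt m | m <- n :: F & val x m].
have hA : X (points_config A).
  apply: (subset_in_shift k2 (x := x)) => a /mapP[m]; rewrite mem_filter => /andP[xm _] ->.
  by rewrite ptK.
have eA m : m \in n :: F -> val (point_of_shift hA) m = val x m.
  move=> mF; rewrite /= /points_config mem_map; last exact: (can_inj (@ptK _ Q)).
  by rewrite mem_filter mF andbT.
rewrite -(hF (point_of_shift hA)); first by rewrite (fin A) // eA // mem_head.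
by move=> m mF; rewrite eA // inE mF orbT.
Qed.

End Centralising.

(** * The ring of integers of a quadratic field *)

Lemma rat_integral (K : fieldExtType rat) (a : rat) :
  integralOver (intr : int -> K) (in_alg K a) -> exists n : int, a = n%:~R.
Proof.
case=> p pm pa.
have pa' : root (map_poly (intr : int -> rat) p) a.
  rewrite -(fmorph_root (in_alg K)) -map_poly_comp.
  rewrite (@eq_map_poly _ _ _ (intr : int -> K)) // => n.
  exact: (rmorph_int (in_alg K)).
have pC : root (map_poly (intr : int -> algC) p) (ratr a).
  rewrite -(@eq_map_poly _ _ (ratr \o (intr : int -> rat))) => [|n /=]; last exact: ratr_int.
  by rewrite map_poly_comp fmorph_root.
have /Cint_rat_Aint : (ratr a : algC) \in Crat by exact: Crat_rat.
have aA : (ratr a : algC) \in Aint.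
  apply: root_monic_Aint pC _ _; first exact: monic_map.
  by apply/polyOverP => j; rewrite coef_map /= rpred_int.
by move=> /(_ aA)/intrP[n]; rewrite -ratr_int => /fmorph_inj ->; exists n.
Qed.

Lemma quadratic_integral (K : fieldExtType rat) (x : K) (t n : int) :
  x * x = t%:~R * x - n%:~R -> integralOver (intr : int -> K) x.
Proof.
move=> e; exists (('X - t%:P) * 'X + n%:P).
  rewrite monicE lead_coefDl ?lead_coefMX ?lead_coefXsubC //.
  by rewrite size_mulX ?polyXsubC_eq0 // size_XsubC (leq_ltn_trans (size_polyC_leq1 _)).
rewrite rmorphD rmorphM rmorphB /= !map_polyX !map_polyC /= rootE.
by rewrite !hornerE mulrBl e; apply/eqP; ring.
Qed.

Lemma unitz_dvd1 (m : int) : m \is a GRing.unit -> (m %| 1)%Z.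
Proof. by move=> um; apply/dvdzP; exists m^-1; rewrite mulVr. Qed.

(** The square of the denominator of [s] is prime to that of the numerator, so it divides [e]. *)
Lemma sqfree_rat_int (e n : int) (s : rat) : square_free e ->
  s * s * e%:~R = n%:~R -> exists S : int, s = S%:~R.
Proof.
move=> esf h; set m := numq s; set w := denq s.
have w0 : (w%:~R : rat) != 0 by rewrite intr_eq0 denq_eq0.
have hs : s = m%:~R / w%:~R by rewrite divq_num_den.
have h2 : m * m * e = n * (w * w).
  apply: (@intr_inj rat); rewrite !intrM -h {1 2}hs.
  by field.
have cop : coprimez (w ^+ 2) (m * m).
  rewrite -expr2 coprimezE !abszX coprimeXl // coprimeXr //.
  by rewrite coprime_sym; exact: coprime_num_den.
have : (w ^+ 2 %| e)%Z.
  by rewrite -(Gauss_dvdzr _ cop) h2 -expr2 dvdz_mull.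
move/esf/unitz_dvd1; rewrite dvdz1 => /eqP w1.
have e1 : w = 1 by have := denq_gt0 s; rewrite -/w; lia.
by exists m; rewrite hs e1 divr1.
Qed.

Section GaloisInt.
Variables (K : fieldExtType rat) (s : galois_group K).

Lemma gal_int_zmod_morphism : zmod_morphism (gal_int s).
Proof. by move=> x y; apply: val_inj; rewrite /= rmorphB. Qed.

Lemma gal_int_monoid_morphism : monoid_morphism (gal_int s).
Proof.
by split=> [|x y]; apply: val_inj; rewrite /= ?rmorph1 ?rmorphM.
Qed.

HB.instance Definition _ := GRing.isZmodMorphism.Build _ _ (gal_int s) gal_int_zmod_morphism.
HB.instance Definition _ := GRing.isMonoidMorphism.Build _ _ (gal_int s) gal_int_monoid_morphism.

End GaloisInt.

Section QuadraticFieldRing.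
Variables (K : fieldExtType rat) (d : int) (r : K).
Hypotheses (d_neq1 : d != 1) (d_sqfree : square_free d).
Hypotheses (r_sqrt : r ^+ 2 = d%:~R) (K_gen : <<1; r>>%VS = fullv).
Variable i : {rmorphism rat -> K}.
Hypothesis iE : forall a, i a = a%:A.
Local Notation O := (ring_of_integers K).

Lemma sqr_neq_d (s : rat) : s * s != d%:~R.
Proof.
apply/eqP => h; have sf1 : square_free 1.
  move=> m /dvdzP[c e]; apply/unitrP; exists (c * m).
  by rewrite e; split; ring.
have [S eS] := @sqfree_rat_int 1 d s sf1 (etrans (mulr1 _) h).
have dS : d = S * S by apply: (@intr_inj rat); rewrite -h eS intrM.
have /d_sqfree/unitz_dvd1 : (S ^+ 2 %| d)%Z by rewrite dS expr2.
by rewrite dvdz1 => /eqP S1; case/eqP: d_neq1; rewrite dS; nia.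
Qed.

Lemma qcoord_exists (x : K) : exists ab : rat * rat, x = i ab.1 + i ab.2 * r.
Proof.
have /Fadjoin1_polyP[p ->] : x \in <<1; r>>%VS by rewrite K_gen memvf.
elim/poly_ind: p => [|p c [[a b] /= IHp]].
  by exists (0, 0); rewrite rmorph0 horner0 /= rmorph0; ring.
exists (b * d%:~R + c, a).
transitivity ((i a + i b * r) * r + i c).
  by rewrite -IHp rmorphD rmorphM /= map_polyX map_polyC /= -iE !hornerE.
by rewrite /= rmorphD rmorphM rmorph_int -r_sqrt; ring.
Qed.

Lemma qcoord_eq0 a b : i a + i b * r = 0 -> a = 0 /\ b = 0.
Proof.
move=> h; have [b0|b0] := eqVneq b 0.
  by move: h; rewrite b0 rmorph0 mul0r addr0 => /eqP; rewrite fmorph_eq0 => /eqP.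
have ib0 : i b != 0 by rewrite fmorph_eq0.
have er : r = i (- a / b).
  rewrite fmorph_div rmorphN; apply: (mulIf ib0); rewrite divfK //.
  by rewrite mulrC; apply/eqP; rewrite -addr_eq0 addrC h.
case/negP: (sqr_neq_d (- a / b)); apply/eqP/(fmorph_inj i).
by rewrite rmorphM -er rmorph_int -r_sqrt expr2.
Qed.

Lemma qcoord_inj a b a' b' : i a + i b * r = i a' + i b' * r -> (a, b) = (a', b').
Proof.
move=> h; have [|/eqP e1 /eqP e2] := @qcoord_eq0 (a - a') (b - b').
  transitivity ((i a + i b * r) - (i a' + i b' * r)); first by rewrite !rmorphB; ring.
  by rewrite h subrr.
by move: e1 e2; rewrite !subr_eq0 => /eqP -> /eqP ->.
Qed.

Lemma qcoord_mul a b a' b' : (i a + i b * r) * (i a' + i b' * r) =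
  i (a * a' + b * b' * d%:~R) + i (a * b' + b * a') * r.
Proof.
rewrite !rmorphD !rmorphM rmorph_int -r_sqrt; ring.
Qed.

Lemma conjugation_exists : exists s : galois_group K, (s : 'AEnd(K)) r = - r.
Proof.
have /choice[q qE] := qcoord_exists.
have qK a b : q (i a + i b * r) = (a, b).
  by rewrite [RHS]surjective_pairing; apply/esym; rewrite [RHS]surjective_pairing;
    apply: qcoord_inj; rewrite -qE.
pose f x := i (q x).1 - i (q x).2 * r.
have fE a b : f (i a + i b * r) = i a - i b * r by rewrite /f qK.
have fl : linear f.
  move=> c x y; rewrite {1}(qE x) {1}(qE y).
  have -> : c *: (i (q x).1 + i (q x).2 * r) + (i (q y).1 + i (q y).2 * r) =
     i (c * (q x).1 + (q y).1) + i (c * (q x).2 + (q y).2) * r.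
    by rewrite -mulr_algl -iE !rmorphD !rmorphM; ring.
  by rewrite fE /f -mulr_algl -iE !rmorphD !rmorphM; ring.
pose F : {linear K -> K} := HB.pack f (GRing.isLinear.Build _ _ _ _ f fl).
have fM : {morph f : x y / x * y}.
  move=> x y; rewrite {1}(qE x) {1}(qE y) qcoord_mul fE /f.
  rewrite !rmorphD !rmorphM rmorph_int -r_sqrt; ring.
have f1 : f 1 = 1.
  have -> : 1 = i 1 + i 0 * r by rewrite rmorph1 rmorph0; ring.
  by rewrite fE; rewrite rmorph0; ring.
have Fh : ahom_in {:K} (linfun F).
  by apply/ahom_inP; split=> [x y _ _|]; rewrite !lfunE /=.
exists (AHom Fh); rewrite -[LHS]/(linfun F r) lfunE -[LHS]/(f r).
have {1}-> : r = i 0 + i 1 * r by rewrite rmorph1 rmorph0; ring.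
by rewrite fE rmorph0 rmorph1; ring.
Qed.

Lemma integer_coord (s : galois_group K) (a b : rat) : (s : 'AEnd(K)) r = - r ->
  i a + i b * r \in @algebraic_integers K ->
  (exists T : int, 2 * a = T%:~R) /\ exists N : int, a * a - d%:~R * b * b = N%:~R.
Proof.
move=> sr xO.
have sE : (s : 'AEnd(K)) (i a + i b * r) = i a - i b * r.
  have lin (f : 'End(K)) : f 1 = 1 -> f r = - r -> f (a%:A + b *: r) = a%:A - b *: r.
    by move=> f1 fr; rewrite linearD !linearZ /= f1 fr scalerN.
  by rewrite !iE !mulr_algl; exact: (lin _ (rmorph1 (s : 'AEnd(K))) sr).
have x'O : i a - i b * r \in @algebraic_integers K.
  by rewrite -sE; exact: (gal_integral s (RingOfIntegers xO)).
move/asboolP: xO => xO; move/asboolP: x'O => x'O.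
split; apply: (@rat_integral K); rewrite /= -iE.
  rewrite (_ : i _ = (i a + i b * r) + (i a - i b * r)); last by rewrite rmorphM rmorph_nat; ring.
  exact: (integral_add (RtoK := intr : {rmorphism int -> K})).
rewrite (_ : i _ = (i a + i b * r) * (i a - i b * r)); last first.
  by rewrite rmorphB !rmorphM rmorph_int -r_sqrt; ring.
exact: (integral_mul (RtoK := intr : {rmorphism int -> K})).
Qed.

(** Handles both cases of [delta] at once. The last clause says that elements with half-integral
    coordinates [T / 2], [S / 2] and integral norm are spanned by 1 and [delta]. It rests on parity:
    modulo 4, [T] and [S] agree in parity if [d] is 1, and both are even if [d] is 2 or 3. *)
Lemma delta_coord : exists (h g : rat) (t n : int),
  [/\ delta d r = i h + i g * r, g != 0, t%:~R = 2 * h, n%:~R = h * h - d%:~R * g * g &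
   forall (T S N : int), T * T - d * S * S = 4 * N -> exists a b : int,
     T%:~R / 2 = a%:~R + b%:~R * h /\ S%:~R / 2 = b%:~R * g].
Proof.
have edivz (c T : int) : 0 < c -> exists T' t, T = c * T' + t /\ 0 <= t < c.
  move=> c0; exists (T %/ c)%Z, (T %% c)%Z; split; first by rewrite {1}(divz_eq T c); ring.
  by rewrite modz_ge0 ?ltz_pmod //; lia.
have bit (T : int) : exists T' t, T = 2 * T' + t /\ (t = 0 \/ t = 1).
  have [T' [t [eT ht]]] := edivz 2 T isT; exists T', t; split=> //; lia.
have [e [f [ed hf]]] := edivz 4 d isT.
rewrite /delta; case: ifPn => d4.
  have f1 : f = 1 by lia.
  exists (1 / 2), (1 / 2), 1, (- e); split=> //.
  - have -> : i (1 / 2) = 1 / 2%:R by rewrite fmorph_div rmorph1 rmorph_nat.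
    by ring.
  - by rewrite ed f1; field.
  - move=> T S N; have [T' [t [-> ht]]] := bit T; have [S' [s [-> hs]]] := bit S.
    move=> h; have ts : t = s.
      by move: h; rewrite ed f1; case: ht hs => -> [] -> //; lia.
    exists (T' - S'), (2 * S' + s); split; last by field.
    by rewrite ts; field.
have f01 : f = 2 \/ f = 3.
  have [f0|nf0] := eqVneq f 0; last by lia.
  have /d_sqfree/unitz_dvd1 : (2 ^+ 2 %| d)%Z by apply/dvdzP; exists e; rewrite ed f0; ring.
  by [].
exists 0, 1, 0, (- d); split=> //.
- by rewrite rmorph0 rmorph1; ring.
- by ring.
- move=> T S N; have [T' [t [-> ht]]] := bit T; have [S' [s [-> hs]]] := bit S.
  move=> h; have [-> ->] : t = 0 /\ s = 0.
    by rewrite ed in h; case: f01 ht hs h => -> [] -> [] -> //; lia.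
  by exists T', S'; split; field.
Qed.

Lemma quad_ring_exists : exists (Q : quad_ring O),
  (exists s : galois_group K, forall x, cj Q x = gal_int s x) /\ oval (dl Q) = delta d r.
Proof.
have [s sr] := conjugation_exists.
have [h [g [t [n [ed g0 et en lattice]]]]] := delta_coord.
have two0 : (2 : rat) != 0 by [].
have sdE a b : (s : 'AEnd(K)) (i a + i b * r) = i a - i b * r.
  have lin (f : 'End(K)) : f 1 = 1 -> f r = - r -> f (a%:A + b *: r) = a%:A - b *: r.
    by move=> f1 fr; rewrite linearD !linearZ /= f1 fr scalerN.
  by rewrite !iE !mulr_algl; exact: (lin _ (rmorph1 (s : 'AEnd(K))) sr).
have dd : delta d r * delta d r = t%:~R * delta d r - n%:~R.
  rewrite ed -!(rmorph_int i) et en qcoord_mul !rmorphB !rmorphD !rmorphM rmorph_nat rmorph_int.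
  by ring.
have dO : delta d r \in @algebraic_integers K.
  by apply/asboolP; exact: quadratic_integral dd.
pose D : O := RingOfIntegers dO.
have ptE (a b : int) : a%:~R + b%:~R * delta d r = i (a%:~R + b%:~R * h) + i (b%:~R * g) * r.
  by rewrite ed rmorphD !rmorphM !rmorph_int; ring.
have pt_inj (a b a' b' : int) : a%:~R + b%:~R * delta d r = a'%:~R + b'%:~R * delta d r :> K ->
    (a, b) = (a', b').
  rewrite !ptE => /qcoord_inj[e1 /(mulIf g0)/intr_inj e2].
  by move: e1; rewrite e2 => /addIr/intr_inj ->.
have ovalE (a b : int) : oval (a%:~R + b%:~R * D) = a%:~R + b%:~R * delta d r.
  by rewrite -[oval _]/(\val _) rmorphD rmorphM !rmorph_int.
have coord (x : O) : exists m : int * int, m.1%:~R + m.2%:~R * D = x.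
  have [[a b] /= ex] := qcoord_exists (oval x).
  have := ovalP x; rewrite ex => /(integer_coord sr)[[T eT] [N eN]].
  (* Trace and norm give [(2 * b) ^ 2 * d = T ^ 2 - 4 * N], and [d] is square-free. *)
  have [S eS] : exists S : int, 2 * b = S%:~R.
    apply: (@sqfree_rat_int d (T * T - 4 * N)) => //.
    by rewrite intrB !intrM -eT -eN; ring.
  have eTS : T * T - d * S * S = 4 * N.
    by apply: (@intr_inj rat); rewrite intrB !intrM -eT -eS -eN; ring.
  have [a' [b' [e1 e2]]] := lattice T S N eTS.
  exists (a', b'); apply: val_inj; apply: (etrans (ovalE a' b')); apply: (etrans _ (esym ex)).
  by rewrite ptE -e1 -e2 -eT -eS; congr (i _ + i _ * r); field.
have /choice[co coE] := coord.
have co_pt a b : co (a%:~R + b%:~R * D) = (a, b).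
  rewrite [LHS]surjective_pairing; apply: pt_inj; rewrite -!ovalE; congr oval; exact: coE.
have sD : gal_int s D = t%:~R - D.
  apply: val_inj; rewrite rmorphB rmorph_int /= ed sdE -(rmorph_int i) et rmorphM rmorph_nat.
  by ring.
have Dn : D * gal_int s D = n%:~R.
  rewrite sD; apply: val_inj; rewrite rmorphM rmorphB !rmorph_int /= mulrBr dd; ring.
have aniso (a b : int) : a * a + t * a * b + n * b * b = 0 -> a = 0 /\ b = 0.
  move=> e; have : (a%:~R + b%:~R * delta d r) * (a%:~R + b%:~R * (t%:~R - delta d r)) = 0 :> K.
    transitivity ((a * a + t * a * b + n * b * b)%:~R : K); last by rewrite e.
    rewrite !intrD !intrM; ring: dd.
  have z0 (a1 b1 : int) : a1%:~R + b1%:~R * delta d r = 0 :> K -> a1 = 0 /\ b1 = 0.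
    move=> e1; have [-> ->] // : (a1, b1) = (0, 0).
    by apply: pt_inj; rewrite e1; ring.
  move/eqP; rewrite mulf_eq0 => /orP[/eqP/z0 //|/eqP e1].
  have [] := z0 (a + b * t) (- b); first by rewrite -e1; ring.
  by lia.
have sat (c : int) (x : O) : c != 0 -> (c %| (co x).1 * 2 + t * (co x).2)%Z ->
    (c * c %| (co x).1 * (co x).1 + t * (co x).1 * (co x).2 + n * (co x).2 * (co x).2)%Z ->
    exists y, x = c%:~R * y.
  move=> c0 /dvdzP[u eu] /dvdzP[w ew].
  have c0' : (c%:~R : K) != 0 by rewrite -(rmorph_int i) fmorph_eq0 intr_eq0.
  pose y := oval x / c%:~R.
  have ox : oval x = (co x).1%:~R + (co x).2%:~R * delta d r by rewrite -ovalE coE.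
  have yO : y \in @algebraic_integers K.
    (* The quotient [y] has trace [u] and norm [w], both integers. *)
    apply/asboolP; apply: (@quadratic_integral _ y u w).
    have e1 : oval x * oval x = (u * c)%:~R * oval x - (w * (c * c))%:~R.
      rewrite -eu -ew ox !intrD !intrM; ring: dd.
    rewrite /y; transitivity ((oval x * oval x) / (c%:~R * c%:~R)); first by field.
    by rewrite e1 !intrM; field.
  exists (RingOfIntegers yO); apply: val_inj.
  by rewrite rmorphM rmorph_int /= /y mulrC divfK.
pose Q := @QuadRing O (gal_int s) D t n co coE co_pt sD Dn aniso sat.
by exists Q; split=> //; exists s.
Qed.

Lemma gal_int_inj (s s' : galois_group K) : gal_int s =1 gal_int s' -> s = s'.
Proof.
move=> ss'.
have rO : r \in @algebraic_integers K.
  apply/asboolP; apply: (@quadratic_integral _ r 0 (- d)).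
  by rewrite -expr2 r_sqrt intrN; ring.
have er := congr1 (@oval K) (ss' (RingOfIntegers rO)).
have lin (f f' : 'End(K)) : f 1 = 1 -> f' 1 = 1 -> f r = f' r -> f = f'.
  move=> f1 f1' fr; apply/lfunP => x; have [[a b] /= ->] := qcoord_exists x.
  by rewrite !iE !mulr_algl !linearD !linearZ /= f1 f1' fr.
apply: val_inj; exact: (lin _ _ (rmorph1 (s : 'AEnd(K))) (rmorph1 (s' : 'AEnd(K))) er).
Qed.

End QuadraticFieldRing.

(** * The centraliser and the normaliser *)

Lemma group_closedP (gT : groupType) (S : set gT) :
  is_subgroup S <-> S 1%g /\ forall x y, S x -> S y -> S (x * y^-1)%g.
Proof.
split=> [[/set_mem S1 SV]|[S1 SV]].
  by split=> // x y Sx Sy; apply/set_mem/SV; exact/mem_set.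
by split; [exact/mem_set|move=> x y /set_mem Sx /set_mem Sy; exact/mem_set/SV].
Qed.

Lemma subgroup_range (gT hT : groupType) (f : hT -> gT) :
  {morph f : x y / (x * y)%g} -> is_subgroup (range f).
Proof.
move=> fM; have f1 : f 1%g = 1%g by apply: (mulgI (f 1%g)); rewrite -fM !mulg1.
have fV x : f x^-1%g = (f x)^-1%g by apply: (mulgI (f x)); rewrite -fM !mulgV.
apply/group_closedP; split; first by exists 1%g.
by move=> _ _ [x _ <-] [y _ <-]; exists (x * y^-1)%g; rewrite ?fM ?fV.
Qed.

Lemma subgroup_normaliser (gT : groupType) (T : set gT) : is_subgroup (normaliser T).
Proof.
apply/group_closedP; split.
  apply/seteqP; split=> [_ [g Tg <-]|g Tg]; first by rewrite mul1g invg1 mulg1.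
  by exists g => //; rewrite mul1g invg1 mulg1.
move=> x y nx ny; have Vy g : T g -> T (y^-1 * g * y)%g.
  by rewrite -{1}ny => -[t Tt <-]; rewrite !mulgA mulVg mul1g mulgVK.
apply/seteqP; split=> [_ [g Tg <-]|g].
  rewrite -nx; exists (y^-1 * g * y)%g; first exact: Vy.
  by rewrite invgM invgK !mulgA.
rewrite -{1}nx => -[t Tt <-]; have : T (y * t * y^-1)%g by rewrite -ny; exists t.
by exists (y * t * y^-1)%g => //; rewrite invgM invgK !mulgA !mulgVK.
Qed.

(** * Symmetries induced by units and Galois automorphisms *)

Section Symmetries.
Variables (K : fieldExtType rat) (k : nat).
Hypothesis k2 : (2 <= k)%N.
Local Notation O := (ring_of_integers K).
Variables (Q : quad_ring O) (conj : galois_group K).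
Hypothesis conjE : forall x, cj Q x = gal_int conj x.
Hypothesis gal_inj : forall s s' : galois_group K, gal_int s =1 gal_int s' -> s = s'.
Local Notation L := (semidirect (gal_action K)).
Local Notation v := (kfree_config Q k).
Local Notation X := (orbit_closure v).
Local Notation translation := (translation v).
Local Notation translate := (@translate v).
Local Notation co := (co Q).
Local Notation pt := (pt Q).
Implicit Types (A B : L) (h : homeo X).

Definition act A (x : O) : O := uval A.1 * gal_int A.2 x.

Lemma gal_intM (s t : galois_group K) x : gal_int (s * t)%g x = gal_int s (gal_int t x).
Proof. by apply: val_inj; rewrite /= comp_lfunE. Qed.

Lemma act_mul A B x : act (A * B)%g x = act A (act B x).
Proof.
transitivity (uval A.1 * gal_int A.2 (uval B.1) * gal_int (A.2 * B.2)%g x) => //.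
by rewrite gal_intM /act rmorphM mulrA.
Qed.

Lemma act_one x : act 1%g x = x.
Proof. by apply: val_inj; rewrite rmorphM rmorph1 mul1r /= id_lfunE. Qed.

Lemma act0 A : act A 0 = 0.
Proof. by rewrite /act rmorph0 mulr0. Qed.

Lemma actD A x y : act A (x + y) = act A x + act A y.
Proof. by rewrite /act rmorphD mulrDr. Qed.

Lemma actK A : cancel (act A) (act A^-1%g).
Proof. by move=> x; rewrite -act_mul mulVg act_one. Qed.

Lemma act_inj : injective act.
Proof.
move=> A B AB.
have e1 : A.1 = B.1.
  by apply: uval_inj; have := congr1 (fun f => f 1) AB; rewrite /act !rmorph1 !mulr1.
have e2 : A.2 = B.2.
  apply: gal_inj => x; have := congr1 (fun f => f x) AB; rewrite /act -e1.
  have /eqP := upairP A.1; rewrite /uval; move: A.1.1 A.1.2 => u w uw e.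
  by rewrite -[LHS]mul1r -[RHS]mul1r -uw mulrAC e mulrAC.
by rewrite [A]surjective_pairing e1 e2 -surjective_pairing.
Qed.

Lemma kfree_act A x : kfree k x -> kfree k (act A x).
Proof.
have k0 : (0 < k)%N by exact: ltnW.
move=> /(kfreeP Q _ k0)[x0 hx]; apply/(kfreeP Q _ k0); split=> [|P pP].
  by apply: contraNneq x0 => e; rewrite -(actK A x) e act0.
have /prime_idealP[iP P1 pP'] := pP.
(* The preimage of [P] under the automorphism; an element whose conjugate is in [P ^ k] lies in
   [P' ^ k], and the unit does not affect membership. *)
pose P' : set O := [set y | P (gal_int A.2 y)].
have pP2 : prime_ideal P'.
  apply/prime_idealP; split; rewrite /P' /=.
  - split=> /=; first by rewrite rmorph0; exact: ideal0.
      by move=> a b; rewrite rmorphD; exact: idealD.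
    by move=> a b; rewrite rmorphM; exact: idealM.
  - by rewrite rmorph1.
  - by move=> a b; rewrite rmorphM; exact: pP'.
have gK y : gal_int A.2 (gal_int A.2^-1%g y) = y.
  by apply: val_inj; rewrite /= -comp_lfunE -[(_ \o _)%VF]/(val (A.2 * A.2^-1)%g) mulgV id_lfunE.
have gVK y : gal_int A.2^-1%g (gal_int A.2 y) = y.
  by apply: val_inj; rewrite /= -comp_lfunE -[(_ \o _)%VF]/(val (A.2^-1 * A.2)%g) mulVg id_lfunE.
have powP n y : ipow P n y -> ipow P' n (gal_int A.2^-1%g y).
  elim: n y => [|n IHn] //= y.
  apply: (@ideal_mul_min _ _ _ [set y | ideal_mul P' (ipow P' n) (gal_int A.2^-1%g y)]) => /=.
  - by rewrite rmorph0; exact: ideal_mul0.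
  - by move=> a b; rewrite rmorphD; exact: ideal_mulD.
  - by move=> a b Pa /IHn Pb; rewrite rmorphM; apply: ideal_mul_in => //; rewrite /P' /= gK.
move=> h; apply: (hx P' pP2); rewrite -(gVK x); apply: powP.
have /eqP uw := upairP A.1; rewrite -[gal_int _ _]mul1r -uw mulrAC mulrC.
by apply: idealM; [exact: ipow_ideal|exact: h].
Qed.

Definition latt A (n : int * int) : int * int := co (act A (pt n)).

Lemma lattD A : {morph latt A : m n / m + n}.
Proof. by move=> m n; rewrite /latt ptD actD coD. Qed.

Lemma latt_mul A B n : latt (A * B)%g n = latt A (latt B n).
Proof. by rewrite /latt coKpt act_mul. Qed.

Lemma latt_one n : latt 1%g n = n.
Proof. by rewrite /latt act_one ptK. Qed.

Lemma lattK A : cancel (latt A) (latt A^-1%g).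
Proof. by move=> n; rewrite -latt_mul mulVg latt_one. Qed.

Lemma lattVK A : cancel (latt A^-1%g) (latt A).
Proof. by move=> n; rewrite -latt_mul mulgV latt_one. Qed.

Lemma lattN A n : latt A (- n) = - latt A n.
Proof. by apply/eqP; rewrite -addr_eq0 -lattD addNr /latt pt0 act0 -(pt0 Q) ptK. Qed.

Lemma kfree_config_latt A n : v (latt A n) = v n.
Proof.
transitivity (`[< kfree k (act A (pt n)) >]).
  by rewrite -(coKpt Q (act A (pt n))).
apply: asbool_equiv_eq; split.
  by move/(kfree_act A^-1%g); rewrite actK.
exact: kfree_act.
Qed.

Lemma latt_in_shift A (x : X) : ((fun n => val x (latt A^-1%g n)) : config) \in orbit_closure v.
Proof.
apply/mem_set/orbit_closureP => F.
have [t ht] := (orbit_closureP v (val x)).1 (set_mem (valP x)) (map (latt A^-1%g) F).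
exists (latt A t) => n nF; apply: (etrans (ht _ (map_f (latt A^-1%g) nF))).
by rewrite -[in LHS](lattK A t) -lattN -lattD kfree_config_latt.
Qed.

Definition symmetry_fun A (x : X) : X :=
  exist _ ((fun n => val x (latt A^-1%g n)) : config) (latt_in_shift A x).

Lemma symmetry_fun_mul A B x : symmetry_fun (A * B)%g x = symmetry_fun A (symmetry_fun B x).
Proof. by apply: val_inj; apply/funext => n /=; rewrite invgM latt_mul. Qed.

Lemma symmetry_fun_one x : symmetry_fun 1%g x = x.
Proof. by apply: val_inj; apply/funext => n /=; rewrite invg1 latt_one. Qed.

Lemma symmetry_funK A : cancel (symmetry_fun A) (symmetry_fun A^-1%g).
Proof. by move=> x; rewrite -symmetry_fun_mul mulVg symmetry_fun_one. Qed.

Lemma symmetry_funVK A : cancel (symmetry_fun A^-1%g) (symmetry_fun A).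
Proof. by move=> x; rewrite -symmetry_fun_mul mulgV symmetry_fun_one. Qed.

Lemma symmetry_fun_continuous A : continuous (symmetry_fun A).
Proof. exact: (@orbit_closure_map_continuous _ (latt A^-1%g)). Qed.

Definition symmetry A : homeo X :=
  Homeo (symmetry_funK A) (symmetry_funVK A)
    (@symmetry_fun_continuous A) (@symmetry_fun_continuous A^-1%g).

Lemma symmetryM : {morph symmetry : A B / (A * B)%g}.
Proof. by move=> A B; apply: homeo_ext => x; exact: symmetry_fun_mul. Qed.

Lemma symmetry1 : symmetry 1%g = 1%g.
Proof. by apply: homeo_ext => x; exact: symmetry_fun_one. Qed.

Lemma symmetry_translate A t (x : X) :
  symmetry A (translate t x) = translate (latt A t) (symmetry A x).
Proof.
apply: val_inj; apply/funext => n; rewrite /= /tshift; congr (val x).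
by rewrite lattD lattN lattK.
Qed.

Local Notation origin := (origin Q k2).

Lemma symmetry_origin A : symmetry A origin = origin.
Proof.
apply: val_inj; apply/funext => n; rewrite -[LHS]/(val origin (latt A^-1%g n)) !originE.
apply/eqP/eqP => [e|->]; last by rewrite /latt pt0 act0 -(pt0 Q) ptK.
by rewrite -(lattVK A n) e /latt pt0 act0 -(pt0 Q) ptK.
Qed.

(** All symmetries fix [origin], so its translates make [symmetry] and [translation] injective and
    their ranges meet trivially. *)
Lemma translate_origin_inj s t : translate s origin = translate t origin -> s = t.
Proof.
move/(congr1 (fun x : X => val x s)).
rewrite -[LHS]/(val origin (s - s)) -[RHS]/(val origin (s - t)) !originE subrr eqxx.
by move=> /esym; rewrite subr_eq0 => /eqP.
Qed.

Lemma latt_inj A B : latt A =1 latt B -> A = B.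
Proof.
move=> h; apply: act_inj; apply/funext => x; apply: (can_inj (@coKpt _ Q)).
by rewrite -(coKpt Q x); exact: h.
Qed.

Lemma symmetry_inj : injective symmetry.
Proof.
move=> A B e; apply: latt_inj => n; apply: translate_origin_inj.
have sT C : translate (latt C n) origin = symmetry C (translate n origin).
  by rewrite symmetry_translate symmetry_origin.
by rewrite !sT e.
Qed.

Lemma translation_inj : injective translation.
Proof.
by move=> s t e; apply: translate_origin_inj; rewrite -[LHS]/(translation s origin) e.
Qed.

Lemma translationD s t : translation (s + t) = (translation s * translation t)%g.
Proof. by apply: homeo_ext => x; apply: val_inj; rewrite /= tshiftD. Qed.

Lemma translation0 : translation 0 = 1%g.
Proof. by apply: homeo_ext => x; apply: val_inj; rewrite /= tshift0. Qed.

Lemma translationN t : translation (- t) = (translation t)^-1%g.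
Proof. by apply: (mulgI (translation t)); rewrite mulgV -translationD subrr translation0. Qed.

(** The image of the empty configuration is invariant under every translation because [M] is onto,
    so it is empty or full; the full configuration meets every residue class. *)
Lemma equivariant_zero h (M : {additive int * int -> int * int}) :
  (forall m, exists n, M n = m) ->
  (forall t x, h (translate t x) = translate (M t) (h x)) ->
  h (point_of_shift (@empty_in_shift _ Q _ k2)) = point_of_shift (@empty_in_shift _ Q _ k2).
Proof.
move=> Msurj hM; set e0 := point_of_shift _.
have inv t : translate t (h e0) = h e0.
  by have [n <-] := Msurj t; rewrite -hM; congr (h _); apply: val_inj; apply/funext.
have const n : val (h e0) n = val (h e0) 0.
  by rewrite -{1}(inv n) /= /tshift subrr.
apply: val_inj; apply/funext => n; rewrite const /= /points_config in_nil; apply/negP => h0.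
have [l [e [_ spl]]] := split_prime_exists Q 0 (ltnW k2).
apply: (shift_misses_residue k2 (x := h e0) spl) => a.
by exists (a, 0); rewrite const phi_pt mul0r addr0 subrr dvdz0.
Qed.

Lemma classification h (M : {additive int * int -> int * int}) :
  (forall m, exists n, M n = m) ->
  (forall t x, h (translate t x) = translate (M t) (h x)) ->
  exists t A, h = (translation t * symmetry A)%g /\ latt A =1 M.
Proof.
move=> Msurj hM.
have h0 := equivariant_zero Msurj hM; set e0 := point_of_shift _ in h0.
(* [h] is injective and fixes the empty configuration, so the image of [origin] has a point; it
   serves to normalise [h]. *)
have [p hp] : exists p, val (h origin) p.
  apply: contrapT => np; have : origin = e0.
    apply: (can_inj (@hfunK _ h)); rewrite h0; apply: val_inj; apply/funext => n.
    by rewrite /= /points_config in_nil; apply/negP => hn; apply: np; exists n.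
  by move/(congr1 (fun x : X => val x 0)); rewrite originE eqxx.
pose h' := (translation (- p) * h)%g : homeo X.
have h'M t x : h' (translate t x) = translate (M t) (h' x).
  by apply: val_inj; rewrite /= hM /= -!tshiftD addrC.
have h'0 : val (h' origin) 0 by rewrite /= /tshift sub0r opprK.
have [A MA] : exists A, latt A =1 M.
  (* A preimage of 1 under [M] shows that [u] is a unit: its conjugate is the inverse of [u]. *)
  have [n en] := Msurj (co 1); set u := ring_map Q M 1.
  have form := equivariant_form (@hfun_continuous _ h') h'M h'0.
  have uw (w : O) : w * u = 1 -> u * w == 1 by rewrite mulrC => ->.
  have eM : ring_map Q M (pt n) = 1 by rewrite /ring_map ptK en coKpt.
  have key (s : galois_group K) : (forall x, ring_map Q M x = gal_int s x * u) ->
      exists A, latt A =1 M.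
    move=> hs; have us : u * gal_int s (pt n) == 1 by apply: uw; rewrite -hs.
    exists (@Units O (u, gal_int s (pt n)) us, s) => m.
    by rewrite /latt /act /uval /= mulrC -hs /ring_map !ptK.
  case: form => form; first by apply: (key conj) => x; rewrite form conjE.
  apply: (key 1%g) => x; rewrite form; congr (_ * _).
  by apply: val_inj; rewrite /= id_lfunE.
exists p, A; split=> //.
(* Removing the symmetry leaves a homeomorphism that commutes with translations and keeps 0 in the
   image of [origin]. *)
pose h'' := (symmetry A^-1 * h')%g : homeo X.
have h''1 : h'' =1 id.
  apply: (@commuting_id _ _ _ k2) => [t x|].
    by rewrite -[LHS]/(symmetry A^-1%g (h' (translate t x))) h'M symmetry_translate -MA lattK.
  rewrite -[val _ _]/(val (h' origin) (latt A^-1^-1%g 0)).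
  by rewrite /latt pt0 act0 -(pt0 Q) ptK.
have e'' : h'' = 1%g by apply: homeo_ext.
have -> : h = (translation p * h')%g by rewrite /h' mulgA -translationD subrr translation0 mul1g.
congr (_ * _)%g.
by apply: (mulgI (symmetry A^-1%g)); rewrite -symmetryM mulVg symmetry1; exact: e''.
Qed.

Local Notation G := (range translation).

Lemma translation_subgroup : is_subgroup G.
Proof.
apply/group_closedP; split; first by exists 0; rewrite ?translation0.
by move=> _ _ [s _ <-] [t _ <-]; exists (s - t); rewrite // translationD translationN.
Qed.

Lemma centraliser_translations : centraliser G = G.
Proof.
apply/seteqP; split=> [h hG|_ [t _ <-] _ [s _ <-]]; last first.
  by rewrite -!translationD addrC.
have hM t x : h (translate t x) = translate t (h x).
  have /(congr1 (fun g : homeo X => g x)) : (translation t * h = h * translation t)%g.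
    by apply: hG; exists t.
  by move=> /esym.
have [|t [A [-> A1]]] := @classification h idfun _ hM; first by move=> m; exists m.
have -> : A = 1%g by apply: latt_inj => n; rewrite A1 latt_one.
by rewrite symmetry1 mulg1; exists t.
Qed.

Lemma symmetry_conj A t :
  (symmetry A * translation t * (symmetry A)^-1)%g = translation (latt A t).
Proof.
apply: (mulIg (symmetry A)); rewrite mulgVK.
by apply: homeo_ext => x; exact: symmetry_translate.
Qed.

Lemma symmetry_normaliser : range symmetry `<=` normaliser G.
Proof.
move=> _ [A _ <-]; apply/seteqP; split=> [_ [_ [t _ <-] <-]|_ [t _ <-]].
  by rewrite symmetry_conj; exists (latt A t).
exists (translation (latt A^-1%g t)); first by exists (latt A^-1%g t).
by rewrite symmetry_conj lattVK.
Qed.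

Lemma translation_normaliser : G `<=` normaliser G.
Proof.
move=> _ [t _ <-]; have e s : (translation t * translation s * (translation t)^-1)%g = translation s.
  by rewrite -translationN -!translationD addrAC addrN add0r.
apply/seteqP; split=> [_ [_ [s _ <-] <-]|_ [s _ <-]]; first by rewrite e; exists s.
by exists (translation s); [exists s|exact: e].
Qed.

(** Conjugation by [h] acts on the translation vectors by a map [M], additive because [translation]
    is an injective morphism, and onto because the normaliser is defined by an equality of sets. *)
Lemma normaliser_decomposition h : normaliser G h ->
  exists t A, h = (translation t * symmetry A)%g.
Proof.
move=> hG.
have /choice[M hM] : forall t, exists t', (h * translation t * h^-1)%g = translation t'.
  move=> t; have : G (h * translation t * h^-1)%g.
    by rewrite -hG; exists (translation t) => //; exists t.
  by case=> t' _ <-; exists t'.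
have MB : zmod_morphism M.
  move=> s t; apply: translation_inj.
  rewrite translationD translationN -!hM translationD translationN.
  by rewrite !invgM invgK !mulgA mulgVK.
pose M' : {additive int * int -> int * int} :=
  HB.pack M (GRing.isZmodMorphism.Build _ _ M MB).
have Msurj m : exists n, M' n = m.
  have : G (translation m) by exists m.
  by rewrite -hG => -[_ [n _ <-]]; rewrite hM => /translation_inj; exists n.
have hM' t x : h (translate t x) = translate (M' t) (h x).
  have : (h * translation t = translation (M t) * h)%g by rewrite -hM mulgVK.
  by move/(congr1 (fun g : homeo X => g x)).
by have [t [A [-> _]]] := classification Msurj hM'; exists t, A.
Qed.

Lemma normaliser_sdprod : is_sdprod (centraliser G) (range symmetry) (normaliser G).
Proof.
rewrite centraliser_translations; split.
- split; [exact: translation_subgroup|exact: subgroup_range symmetryM|].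
  exact: subgroup_normaliser.
- split; first exact: translation_normaliser.
  by move=> r n nr Gn; rewrite -nr; exists n.
- exact: symmetry_normaliser.
- apply/seteqP; split=> [_ [[t _ <-] [A _ e]]|_ ->].
    suff -> : t = 0 by rewrite translation0.
    apply: translate_origin_inj; rewrite -[LHS]/(translation t origin) -e symmetry_origin.
    by rewrite -[RHS]/(translation 0 origin) translation0.
  by split; [exists 0; rewrite ?translation0|exists 1%g; rewrite ?symmetry1].
- apply/seteqP; split=> [_ [n Gn [h Hh <-]]|h /normaliser_decomposition[t [A ->]]].
    have /group_closedP[_ nV] := subgroup_normaliser G.
    have /group_closedP[_ HV] := subgroup_range symmetryM.
    rewrite -[h]invgK; apply: nV; first exact: translation_normaliser.
    apply: symmetry_normaliser; rewrite -[h^-1%g]mul1g; apply: HV => //.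
    by exists 1%g; rewrite ?symmetry1.
  by exists (translation t); [exists t|exists (symmetry A) => //; exists A].
Qed.

End Symmetries.

Theorem theorem4p4 (K : fieldExtType rat) (d : int) (r : K) (k : nat)
    (d_neq0 : d != 0) (d_neq1 : d != 1) (d_sqfree : square_free d)
    (r_sqrt : r ^+ 2 = d%:~R) (K_gen : <<1; r>>%VS = fullv)
    (k_ge2 : (2 <= k)%N) :
  let v := char_fun (kfree_points d r k) in
  let G := range (translation v) in
  [/\ centraliser G = G,
      (injective (translation v) /\
       forall s t, translation v (s + t) = (translation v s * translation v t)%g) &
      exists H : set (homeo (orbit_closure v)),
        is_sdprod (centraliser G) H (normaliser G) /\
        is_isomorphic_to H (semidirect (gal_action K))].
Proof.
have iE a : in_alg K a = a%:A by [].
have [Q [[conj conjE] dlE]] := quad_ring_exists d_neq1 d_sqfree r_sqrt K_gen iE.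
have gal_inj := gal_int_inj r_sqrt K_gen iE.
have ptE m : oval (pt Q m) = m.1%:~R + m.2%:~R * delta d r.
  by rewrite -dlE -[LHS]/(\val _) rmorphD rmorphM !rmorph_int.
have -> : char_fun (kfree_points d r k) = kfree_config Q k.
  congr char_fun; apply/seteqP; split=> m.
    by move=> [x ex kx]; rewrite /= (_ : pt Q m = x) //; apply: val_inj; rewrite -[LHS]/(oval _) ptE.
  by move=> km; exists (pt Q m).
move=> v G; split.
- exact: (centraliser_translations k_ge2 conjE gal_inj).
- by split; [exact: (translation_inj k_ge2)|exact: translationD].
exists (range (symmetry k_ge2 Q)); split.
  exact: (normaliser_sdprod k_ge2 conjE gal_inj).
exists (symmetry k_ge2 Q); split=> //; first exact: symmetryM.
exact: (symmetry_inj gal_inj).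
Qed.
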